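(* Let $(S,d)$ be a complete separable metric space. Let $(\mu_n)_{n\in\mathbb{N}}\subset \mathcal{M}(S)$ be a sequence such that $\sup_n\|\mu_n\|_{\mathrm{TV}}<\infty$. If for every $f\in\mathrm{BL}(S)$ the sequence of real numbers $\langle\mu_n,f\rangle$ converges, then there exists $\mu\in\mathcal{M}(S)$ such that $\|\mu_n-\mu\|_{\mathrm{BL}}^*\to 0$ as $n\to\infty$.
   Context: $\mathcal{M}(S)$ is the real vector space of finite signed Borel measures on $S$, and $\langle\mu,f\rangle:=\int_S f\,d\mu$. For $f:S\to\mathbb{R}$, $|f|_L:=\sup\{|f(x)-f(y)|/d(x,y): x,y\in S,\ x\neq y\}$. $\mathrm{BL}(S)$ is the space of bounded real-valued Lipschitz functions on $(S,d)$ with norm $\|f\|_{\mathrm{BL}}:=\|f\|_\infty+|f|_L$. For $\mu\in\mathcal{M}(S)$, $\|\mu\|_{\mathrm{BL}}^*:=\sup\{|\langle\mu,f\rangle|: f\in\mathrm{BL}(S),\ \|f\|_{\mathrm{BL}}\le 1\}$ (dual bounded Lipschitz norm), and $\|\mu\|_{\mathrm{TV}}:=|\mu|(S)=\mu^+(S)+\mu^-(S)$ is the total variation norm, where $\mu=\mu^+-\mu^-$ is the Jordan decomposition. *)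

(* Defs.v *)
From HB Require Import structures.
From mathcomp Require Import all_boot all_order all_algebra.
From mathcomp Require Import all_classical all_reals all_analysis.

Set Implicit Arguments.
Unset Strict Implicit.
Unset Printing Implicit Defensive.

Import Order.TTheory GRing.Theory Num.Theory.
Import numFieldNormedType.Exports.

Local Open Scope classical_set_scope.
Local Open Scope ring_scope.
Local Open Scope charge_scope.

(* Metric is a structure on a possibly empty type; Complete brings in a
   distinguished point, as does every measurable type of the library. *)
#[short(type="completeMetricType")]
HB.structure Definition CompleteMetric (K : numDomainType) :=
  {T of Metric K T & Complete T}.

Definition separable_space (S : topologicalType) : Prop :=
  exists2 D : set S, countable D & dense D.

Notation Borel S := (g_sigma_algebraType (@open S)).

(* M(S). Only the values on Borel sets are meaningful: a charge is a function
   on all subsets, but it is unconstrained outside the measurable ones. *)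
Notation signed_measure R S := ({charge set (Borel S) -> \bar R}%R).

Section jordan.
Context (d : measure_display) (T : measurableType d) (R : realType).
Variable nu : {charge set T -> \bar R}.

Lemma hahn_pair_exists :
  exists PN : set T * set T, hahn_decomposition nu PN.1 PN.2.
Proof. by have [P [N h]] := Hahn_decomposition nu; exists (P, N). Qed.

(* A Hahn decomposition is unique up to null sets, so this choice does not affect
   the Jordan parts. *)
Definition hahn_choice := svalP (cid hahn_pair_exists).

Definition pos_part : {finite_measure set T -> \bar R} :=
  jordan_pos hahn_choice.

Definition neg_part : {finite_measure set T -> \bar R} :=
  jordan_neg hahn_choice.

Definition TV_norm : \bar R := (pos_part setT + neg_part setT)%E.

Definition pairing (f : T -> R) : R :=
  \int[pos_part]_x f x - \int[neg_part]_x f x.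

End jordan.

Section bounded_lipschitz.
Context (R : realType) (S : completeMetricType R).
Implicit Type f : S -> R.

(* The maximum with 0 only matters when S is a single point: the supremum is then
   over the empty set, which the library sends to -oo, and the seminorm is 0. *)
Definition lip_seminorm f : \bar R :=
  maxe 0%E (ereal_sup [set (`|f p.1 - f p.2| / mdist p.1 p.2)%:E
                    | p in [set p : S * S | p.1 != p.2]]).

Definition sup_norm f : \bar R := ereal_sup [set `|f x|%:E | x in setT].

Definition BL_norm f : \bar R := (sup_norm f + lip_seminorm f)%E.

Definition BL : set (S -> R) :=
  [set f | bounded_fun f /\
           exists L : R, forall x y, `|f x - f y| <= L * mdist x y].

Definition BL_dual_norm (mu : signed_measure R S) : \bar R :=
  ereal_sup [set `|pairing mu f|%:E | f in [set f | BL f /\ (BL_norm f <= 1)%E]].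

End bounded_lipschitz.

(* Main.v *)
Require Import Defs.
From HB Require Import structures.
From mathcomp Require Import all_boot all_order all_algebra.
From mathcomp Require Import all_classical all_reals all_analysis.
From mathcomp Require Import measurable_realfun.
From mathcomp Require Import ring lra.

(** Two facts carry the proof.

    The first is a Schur property ([schur]): if uniformly bounded signed measures
    [nu_n] satisfy [<nu_n, f> -> 0] for every bounded Lipschitz [f], then the
    convergence is uniform on the unit ball. Otherwise [<nu_k, f_k> > e] for unit
    vectors [f_k]. The unit ball is compact for pointwise convergence, so after
    subtracting a cluster point the [f_k] become small near any prescribed finite
    set. Each [nu_k] is concentrated near a finite set [F_k]; multiplying [f_k] by
    cutoffs that vanish near the earlier sets and away from [F_k] costs little, and
    leaves humps whose supports keep a fixed distance from one another. All cutoffs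
    being at one fixed scale, the humps add up to one bounded Lipschitz function, and
    the pairings of this function with the [nu_k] do not tend to 0.

    Applied to differences of the [mu_n], the Schur property says that [mu_n] is
    Cauchy for the dual norm, hence converges uniformly on the unit ball to the
    functional [phi f = lim <mu_n, f>]. It remains to see that [phi] is given by a
    signed measure.

    The second fact is a representation theorem ([representation]). Being a limit in
    the dual norm, [phi] is small on functions with a given Lipschitz constant that
    vanish near a suitable finite set. Its positive part in the sense of Riesz,
    [psi f = sup {phi g | 0 <= g <= f}], is then small on all functions between 0
    and 1 that vanish near a suitable finite set: otherwise one could add up
    arbitrarily many disjointly supported functions on each of which [phi] exceeds a
    fixed threshold, contradicting the boundedness of [phi] ([fun_pos_tight]).
    Together with completeness this gives the Daniell property ([pos_daniell]), and Daniell's outer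
    measure, defined with countable covers by functions, restricts to a Borel measure
    whose integral is [psi]. The same applies to [- phi], and [phi] is the difference
    of the two positive parts.

    Functionals on bounded Lipschitz functions, rather than measures, are the objects
    of most statements, because the limit is only known to be a functional until the
    end. *)

Set Implicit Arguments.
Unset Strict Implicit.
Unset Printing Implicit Defensive.

Import Order.TTheory GRing.Theory Num.Theory.
Import numFieldNormedType.Exports.

Local Open Scope classical_set_scope.
Local Open Scope ring_scope.

(** * Truncation to the unit interval *)

Section clamp.
Context {R : realType}.
Implicit Types s t : R.

Definition clamp t : R := Num.max 0 (Num.min 1 t).

Lemma clamp_ge0 t : 0 <= clamp t.
Proof. by rewrite le_max lexx. Qed.

Lemma clamp_le1 t : clamp t <= 1.
Proof. by rewrite ge_max ler01 ge_min lexx. Qed.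

Lemma clamp0 t : t <= 0 -> clamp t = 0.
Proof. by move=> t0; apply/max_idPl; rewrite ge_min t0 orbT. Qed.

Lemma clamp1 t : 1 <= t -> clamp t = 1.
Proof.
by move=> t1; rewrite /clamp min_l// max_r.
Qed.

Lemma le_clamp s t : s <= t -> clamp s <= clamp t.
Proof.
by move=> st; rewrite /clamp ge_max !le_max lexx/= le_min !ge_min lexx/= st !orbT.
Qed.

Lemma clamp_lip s t : `|clamp s - clamp t| <= `|s - t|.
Proof.
have dist_ge (a b : R) : a - b <= `|a - b| by exact: ler_norm.
have := dist_ge s t; have := dist_ge t s; rewrite (distrC t s) => h1 h2.
have d0 := normr_ge0 (s - t).
rewrite ler_norml /clamp; apply/andP; split.
  by case: (lerP 1 s); case: (lerP 1 t) => ? ?;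
    rewrite ?maxEle; repeat case: ifPn; rewrite -?ltNge => *; lra.
by case: (lerP 1 s); case: (lerP 1 t) => ? ?;
    rewrite ?maxEle; repeat case: ifPn; rewrite -?ltNge => *; lra.
Qed.

(** The layer-cake decomposition through which integrals are compared with
    functionals. *)
Lemma sum_clamp t (K : nat) : 0 <= t <= K%:R -> \sum_(i < K) clamp (t - i%:R) = t.
Proof.
move=> /andP[t0 tK].
have -> : \sum_(i < K) clamp (t - i%:R) = Num.min t K%:R.
  elim: K {tK} => [|K IH]; first by rewrite big_ord0 min_r.
  rewrite big_ord_recr/= IH /clamp -natr1.
  case: (lerP t K%:R) => tK.
    rewrite [Num.min t _]min_l; last lra.
    by rewrite [X in Num.max _ X]min_r; [rewrite max_l; lra|lra].
  case: (lerP t (K%:R + 1)) => tK1.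
    by rewrite [Num.min 1 _]min_r; [rewrite max_r; lra|lra].
  by rewrite [Num.min 1 _]min_l; [rewrite max_r; lra|lra].
by rewrite min_l.
Qed.

End clamp.

(** * Bounded Lipschitz functions and cutoffs *)

Section bounded_lipschitz_functions.
Context {R : realType} {S : completeMetricType R}.
Implicit Types (f g : S -> R) (F G : seq S) (x y z : S).

Definition bounded_lip (C L : R) f :=
  (forall x, `|f x| <= C) /\ forall x y, `|f x - f y| <= L * mdist x y.

Lemma bounded_lip_le C C' L L' f : C <= C' -> L <= L' ->
  bounded_lip C L f -> bounded_lip C' L' f.
Proof.
move=> CC LL [fC fL]; split=> [x|x y]; first exact: le_trans (fC x) CC.
by apply: le_trans (fL x y) _; rewrite ler_wpM2r// mdist_ge0.
Qed.

Lemma BLP f : BL f <-> exists C L, [/\ 0 <= C, 0 <= L & bounded_lip C L f].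
Proof.
split=> [[[M [Mr fM]] [L fL]]|[C [L [C0 L0 [fC fL]]]]].
  exists (`|M| + 1), `|L|; split => //.
  apply: (@bounded_lip_le (`|M| + 1) _ L) => //; first exact: ler_norm.
  split=> // x; apply: fM => //; rewrite (le_lt_trans (ler_norm M))//.
  by rewrite ltrDl.
split; last by exists L.
exists C; split; first exact: ger0_real.
by move=> A CA x _ /=; rewrite (le_trans (fC x))// ltW.
Qed.

Lemma bounded_lip_BL C L f : bounded_lip C L f -> BL f.
Proof.
move=> fb; apply/BLP; exists `|C|, `|L|; split => //.
by apply: bounded_lip_le fb; exact: ler_norm.
Qed.

Lemma bounded_lip_cst (c : R) : bounded_lip `|c| 0 (fun=> c : R).
Proof. by split=> // x y; rewrite subrr normr0 mul0r. Qed.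

Lemma bounded_lipD C L C' L' f g : bounded_lip C L f -> bounded_lip C' L' g ->
  bounded_lip (C + C') (L + L') (fun x => f x + g x).
Proof.
move=> [fC fL] [gC gL]; split=> [x|x y].
  by rewrite (le_trans (ler_normD _ _))// lerD.
by rewrite mulrDl opprD addrACA (le_trans (ler_normD _ _))// lerD.
Qed.

Lemma bounded_lipB C L C' L' f g : bounded_lip C L f -> bounded_lip C' L' g ->
  bounded_lip (C + C') (L + L') (fun x => f x - g x).
Proof.
move=> fb [gC gL]; apply: (bounded_lipD fb (g := fun x => - g x)).
split=> [x|x y]; first by rewrite normrN.
by rewrite opprK addrC distrC.
Qed.

Lemma bounded_lipM C L C' L' f g : 0 <= C -> 0 <= C' -> 0 <= L -> 0 <= L' ->
  bounded_lip C L f -> bounded_lip C' L' g ->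
  bounded_lip (C * C') (L * C' + C * L') (fun x => f x * g x).
Proof.
move=> C0 C'0 L0 L'0 [fC fL] [gC gL]; split=> [x|x y].
  by rewrite normrM ler_pM.
have -> : f x * g x - f y * g y = (f x - f y) * g x + f y * (g x - g y) by ring.
rewrite (le_trans (ler_normD _ _))// [leRHS]mulrDl !normrM lerD//.
  by rewrite mulrAC ler_pM.
by rewrite -mulrA ler_pM.
Qed.

Lemma bounded_lip_clamp C L f : bounded_lip C L f ->
  bounded_lip 1 L (fun x => clamp (f x)).
Proof.
move=> [_ fL]; split=> [x|x y]; first by rewrite ger0_norm ?clamp_ge0// clamp_le1.
exact: le_trans (clamp_lip _ _) (fL x y).
Qed.

Lemma BL_cst (c : R) : BL (fun _ : S => c).
Proof. exact: bounded_lip_BL (bounded_lip_cst c). Qed.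

Lemma BLD f g : BL f -> BL g -> BL (fun x => f x + g x).
Proof.
move=> /BLP[C [L [_ _ fb]]] /BLP[C' [L' [_ _ gb]]].
exact: bounded_lip_BL (bounded_lipD fb gb).
Qed.

Lemma BLM f g : BL f -> BL g -> BL (fun x => f x * g x).
Proof.
move=> /BLP[C [L [? ? fb]]] /BLP[C' [L' [? ? gb]]].
exact: bounded_lip_BL (bounded_lipM _ _ _ _ fb gb).
Qed.

Lemma BLZ (a : R) f : BL f -> BL (fun x => a * f x).
Proof. by move=> fb; apply: BLM fb; exact: BL_cst. Qed.

Lemma BLN f : BL f -> BL (fun x => - f x).
Proof.
by move=> /(BLZ (-1)); under eq_fun do rewrite mulN1r.
Qed.

Lemma BLB f g : BL f -> BL g -> BL (fun x => f x - g x).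
Proof. by move=> fb /BLN; exact: BLD. Qed.

Lemma BL_clamp f : BL f -> BL (fun x => clamp (f x)).
Proof.
by move=> /BLP[C [L [_ _ fb]]]; exact: bounded_lip_BL (bounded_lip_clamp fb).
Qed.

Lemma BL_max0 f : BL f -> BL (fun x => Num.max 0 (f x)).
Proof.
move=> /BLP[C [L [C0 L0 [fC fL]]]].
apply: (@bounded_lip_BL C L); split=> [x|x y].
  have := fC x; rewrite !ler_norml => /andP[h1 h2].
  by rewrite le_max ge_max oppr_le0 C0/= h2.
apply: le_trans (fL x y); have := ler_norm (f x - f y).
have := ler_norm (f y - f x); rewrite (distrC (f y)) => h1 h2.
have h0 := normr_ge0 (f x - f y).
rewrite ler_norml; apply/andP; split;
  by case: (lerP 0 (f x)); case: (lerP 0 (f y)) => ? ?; lra.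
Qed.

Lemma BL_min f g : BL f -> BL g -> BL (fun x => Num.min (f x) (g x)).
Proof.
move=> fb gb; rewrite (_ : (fun x => _) = fun x => f x - Num.max 0 (f x - g x)).
  by apply: BLB => //; apply: BL_max0; exact: BLB.
apply/funext => x; case: (lerP (f x) (g x)) => ?.
  by rewrite max_l; lra.
by rewrite max_r; lra.
Qed.

Lemma BL_sum (I : Type) (r : seq I) (h : I -> S -> R) :
  (forall i, BL (h i)) -> BL (fun x => \sum_(i <- r) h i x).
Proof.
move=> hb; elim: r => [|i r IH].
  by under eq_fun do rewrite big_nil; exact: BL_cst.
by under eq_fun do rewrite big_cons; exact: BLD.
Qed.

(** Distance to a finite set, capped at 1 so that it is bounded and makes sense
    for the empty set. *)
Definition dist_fin F x : R := \big[Num.min/1]_(y <- F) mdist x y.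

Lemma dist_fin_le1 F x : dist_fin F x <= 1.
Proof.
by rewrite /dist_fin; elim/big_rec: _ => // y z _ z1; rewrite ge_min z1 orbT.
Qed.

Lemma dist_fin_ge0 F x : 0 <= dist_fin F x.
Proof.
by rewrite /dist_fin; elim/big_rec: _ => // y z _ z0; rewrite le_min z0 mdist_ge0.
Qed.

Lemma dist_fin_cat F G x :
  dist_fin (F ++ G) x = Num.min (dist_fin F x) (dist_fin G x).
Proof.
rewrite /dist_fin; elim: F => [|y F IH] /=; last by rewrite !big_cons IH minA.
by rewrite big_nil min_r//; exact: dist_fin_le1.
Qed.

Lemma dist_fin_le F x y : y \in F -> dist_fin F x <= mdist x y.
Proof.
elim: F => //= z F IH; rewrite inE /dist_fin big_cons ge_min => /orP[/eqP->|/IH].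
  by rewrite lexx.
by rewrite /dist_fin => ->; rewrite orbT.
Qed.

Lemma dist_fin_lt F x (r : R) : r <= 1 -> dist_fin F x < r ->
  exists2 y, y \in F & mdist x y < r.
Proof.
move=> r1; elim: F => [|z F IH]; rewrite /dist_fin ?big_nil ?big_cons.
  by rewrite ltNge r1.
rewrite gt_min => /orP[xz|/IH[y yF xy]]; first by exists z; rewrite ?mem_head.
by exists y; rewrite // inE yF orbT.
Qed.

Lemma dist_fin_lip F x y : `|dist_fin F x - dist_fin F y| <= mdist x y.
Proof.
suff h a b : dist_fin F a - dist_fin F b <= mdist a b.
  by rewrite ler_norml h andbT lerNl opprB metric_sym h.
rewrite lerBlDr /dist_fin; elim: F => [|z F IH].
  by rewrite !big_nil lerDr mdist_ge0.
rewrite !big_cons addr_minr le_min !ge_min metric_triangle/=.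
by rewrite IH orbT.
Qed.

(** A cutoff that rises from 0 to 1 as the distance to [F] goes from [r] to
    [r + d]. *)
Definition far F (r d : R) x : R := clamp ((dist_fin F x - r) / d).

Lemma far0 F r d x : 0 < d -> dist_fin F x <= r -> far F r d x = 0.
Proof. by move=> d0 xr; rewrite /far clamp0// pmulr_lle0 ?invr_gt0// subr_le0. Qed.

Lemma far1 F r d x : 0 < d -> r + d <= dist_fin F x -> far F r d x = 1.
Proof. by move=> d0 xr; rewrite /far clamp1// ler_pdivlMr// mul1r lerBrDl. Qed.

Lemma far_ge0 F r d x : 0 <= far F r d x. Proof. exact: clamp_ge0. Qed.

Lemma far_le1 F r d x : far F r d x <= 1. Proof. exact: clamp_le1. Qed.

Lemma bounded_lip_far F r d : 0 < d -> bounded_lip 1 d^-1 (far F r d).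
Proof.
move=> d0; split=> [x|x y]; first by rewrite ger0_norm ?far_ge0// far_le1.
apply: le_trans (clamp_lip _ _) _.
rewrite -mulrBl opprB addrA subrK normrM mulrC (gtr0_norm (x := d^-1)) ?invr_gt0//.
by rewrite ler_pM2l ?invr_gt0// dist_fin_lip.
Qed.

Lemma BL_far F r d : 0 < d -> BL (far F r d).
Proof. by move=> d0; exact: bounded_lip_BL (bounded_lip_far _ _ d0). Qed.

Lemma bounded_lip_near F r d : 0 < d ->
  bounded_lip 1 d^-1 (fun x => 1 - far F r d x).
Proof.
move=> d0; have [_ fL] := bounded_lip_far F r d0.
split=> [x|x y].
  by have := far_ge0 F r d x; have := far_le1 F r d x => ? ?; rewrite ger0_norm; lra.
by rewrite opprB addrC addrA subrK distrC.
Qed.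

End bounded_lipschitz_functions.

(** * Functionals *)

Section functionals.
Context {R : realType} {S : completeMetricType R}.
Implicit Types (f g : S -> R) (T : (S -> R) -> R).

Definition linear_on_BL T := forall a f g, BL f -> BL g ->
  T (fun x => a * f x + g x) = a * T f + T g.

Definition bounded_by (M : R) T := forall C f, BL f ->
  (forall x, `|f x| <= C) -> `|T f| <= M * C.

(** Concentration near finite sets, at every scale: the trace left on functionals
    by the inner regularity of a finite Borel measure. Finite sets replace compact
    ones, so that only separability is needed to establish it. *)
Definition tight T := forall d e : R, 0 < d -> 0 < e -> exists F : seq S,
  forall f, BL f -> (forall x, `|f x| <= 1) ->
    (forall x, dist_fin F x < d -> f x = 0) -> `|T f| <= e.

Section linear.
Variable T : (S -> R) -> R.
Hypothesis linT : linear_on_BL T.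

Lemma lin_comp a f g h : BL f -> BL g -> (forall x, h x = a * f x + g x) ->
  T h = a * T f + T g.
Proof. by move=> fb gb hE; rewrite -linT//; congr T; apply/funext. Qed.

Lemma linD f g : BL f -> BL g -> T (fun x => f x + g x) = T f + T g.
Proof.
by move=> fb gb; rewrite (@lin_comp 1 f g)// ?mul1r// => x; rewrite mul1r.
Qed.

Lemma lin0 : T (fun=> 0) = 0.
Proof.
have : T (fun=> 0) = 1 * T (fun=> 0) + T (fun=> 0).
  by apply: lin_comp => [||x]; [exact: BL_cst|exact: BL_cst|rewrite mulr0 addr0].
lra.
Qed.

Lemma linZ a f : BL f -> T (fun x => a * f x) = a * T f.
Proof.
move=> fb; rewrite (@lin_comp a f (fun=> 0)) ?lin0 ?addr0//; first exact: BL_cst.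
by move=> x; rewrite addr0.
Qed.

Lemma linB f g : BL f -> BL g -> T (fun x => f x - g x) = T f - T g.
Proof.
move=> fb gb; rewrite (@lin_comp (-1) g f)//; first by rewrite mulN1r addrC.
by move=> x; rewrite mulN1r addrC.
Qed.

Lemma linN f : BL f -> T (fun x => - f x) = - T f.
Proof.
by move=> fb; rewrite -mulN1r -linZ//; congr T; apply/funext => x; rewrite mulN1r.
Qed.

End linear.

End functionals.

(** * The Schur property *)

Section ultralimit.
Context {R : realType} {S : completeMetricType R}.

(** Compactness of the unit ball for pointwise convergence, along an ultrafilter so
    that no subsequence has to be extracted. *)
Lemma ultra_pointwise_limit (U : set_system nat) (f : nat -> S -> R) :
  UltraFilter U -> (forall k, bounded_lip 1 1 (f k)) ->
  exists2 g : S -> R, bounded_lip 1 1 g & forall x, f k x @[k --> U] --> g x.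
Proof.
move=> UU fb.
have lim_x x : exists l : R, f k x @[k --> U] --> l.
  have [|l [_ cl]] := @segment_compact R (-1) 1 (f k x @[k --> U]) _.
    by apply: nearW => k /=; rewrite in_itv/= -ler_norml; exact: (fb k).1.
  exists l => V Vl; have [//|UV] := in_ultra_setVsetC (f ^~ x @^-1` V) UU.
  by have [z []] := cl _ _ (UV : (f k x @[k --> U]) (~` V)) Vl.
have [g gl] := choice lim_x; exists g => //.
have near_x x (e : R) : 0 < e -> \forall k \near U, `|g x - f k x| < e.
  by move=> e0; have /cvgrPdist_lt := gl x; exact.
split=> [x|x y]; apply/ler_addgt0Pr => e e0.
  have [k fx] := filter_ex (near_x x _ e0).
  have := (fb k).1 x; have := ler_normD (g x - f k x) (f k x).
  by rewrite subrK; lra.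
have e2 : 0 < e / 2 by lra.
have [k [fx fy]] := filter_ex (filterI (near_x x _ e2) (near_x y _ e2)).
have := (fb k).2 x y; rewrite mul1r.
have -> : g x - g y = (g x - f k x) + (f k x - f k y) - (g y - f k y) by ring.
have := ler_normB (g x - f k x + (f k x - f k y)) (g y - f k y).
have := ler_normD (g x - f k x) (f k x - f k y); lra.
Qed.

Lemma near_finite_set (U : set_system nat) (f : nat -> S -> R) (g : S -> R) :
  Filter U -> (forall x, f k x @[k --> U] --> g x) ->
  forall (F : seq S) (e : R), 0 < e ->
    \forall k \near U, forall y, y \in F -> `|g y - f k y| < e.
Proof.
move=> FU fg F e e0; elim: F => [|z F IH]; first by near=> k.
have /cvgrPdist_lt/(_ _ e0) := fg z => fz.
apply: filterS (filterI fz IH) => k [kz kF] y.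
by rewrite inE => /orP[/eqP->|/kF].
Unshelve. all: by end_near. Qed.

End ultralimit.

Section gliding_hump.
Context {R : realType} {S : completeMetricType R}.
Variables (M : R) (T : nat -> (S -> R) -> R).
Hypothesis linT : forall n, linear_on_BL (T n).
Hypothesis bndT : forall n, bounded_by M (T n).
Hypothesis tightT : forall n, tight (T n).
Hypothesis T0 : forall f, BL f -> T n f @[n --> \oo] --> (0 : R).

(** [h] is the next hump, chosen for [T k] and supported near the finite set [F] where
    [T k] is concentrated; [H] is the sum of the earlier humps, which live near [L].
    The support of [h] stays [d] away from that of [H], and its Lipschitz constant
    depends on [d] only. *)
Definition hump (e d : R) N L (H : S -> R) k F (h : S -> R) : Prop :=
  [/\ (N <= k)%N /\ `|T k H| <= d,
    bounded_lip 2 (2 + 4 / d) h,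
    (forall x, h x != 0 -> dist_fin F x < 2 * d /\ 3 * d < dist_fin L x),
    (forall v, BL v -> (forall x, `|v x| <= 1) ->
      (forall x, dist_fin F x < d -> v x = 0) -> `|T k v| <= d) &
    e - (3 + 9 * M) * d <= T k h].

(** How humps arise: if [T k] is large on a unit vector [f k] for every [k], subtract
    from [f k] an ultralimit [g] of the sequence, to make it small near the finite set
    [L] of the earlier humps, and cut off the result near [L] and away from the
    finite set [F] near which [T k] is concentrated. *)
Lemma gliding_step (e d : R) (f : nat -> S -> R) (N : nat) (L : seq S)
    (H : S -> R) :
  0 < d -> d <= 4^-1 -> (forall k, bounded_lip 1 1 (f k)) ->
  (forall k, e < T k (f k)) -> BL H ->
  exists k F h, hump e d N L H k F h.
Proof.
move=> d0 d4 fb Tf bH.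
have [U [UU Uoo]] := @ultraFilterLemma nat \oo _.
have [g gb fg] := ultra_pointwise_limit UU fb.
have bg := bounded_lip_BL gb.
have small v : BL v -> \forall k \near U, `|T k v| < d.
  move=> bv; apply: Uoo; have /cvgrPdist_lt/(_ _ d0) := T0 bv.
  by apply: filterS => k; rewrite sub0r normrN.
have [k [[[Nk kH] kg] kL]] := filter_ex (filterI (filterI (filterI
  (Uoo _ (nbhs_infty_ge N)) (small _ bH)) (small _ bg))
  (near_finite_set _ fg L d0)).
have [F FP] := tightT k d0 d0.
pose u x := f k x - g x.
have ub : bounded_lip 2 2 u := bounded_lipB (fb k) gb.
have bu := bounded_lip_BL ub.
have p2 : (0 : R) <= 2 by [].
have i0 : 0 <= d^-1 by rewrite invr_ge0 ltW.
have ab := bounded_lip_far L (3 * d) d0.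
have bb := bounded_lip_near F d d0.
set a := far L (3 * d) d in ab; set b := far F d d in bb.
have ba := bounded_lip_BL ab; have bb' := bounded_lip_BL bb.
have bua := BLM bu ba.
have uab : bounded_lip 2 (2 + 2 * d^-1) (fun x => u x * a x).
  by have := bounded_lipM p2 ler01 p2 i0 ub ab; rewrite !mulr1.
exists k, F, (fun x => u x * a x * (1 - b x)); split.
- by split=> //; exact: ltW.
- have l0 : 0 <= 2 + 2 * d^-1 by lra.
  have := bounded_lipM p2 ler01 l0 i0 uab bb; rewrite !mulr1.
  by apply: bounded_lip_le => //; lra.
- move=> x; rewrite !mulf_eq0 !negb_or => /andP[/andP[_ ax] bx]; split.
    rewrite ltNge; apply: contra bx => Fx.
    by rewrite /b far1 ?subrr//; lra.
  by rewrite ltNge; apply: contra ax => Lx; rewrite /a far0.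
- exact: FP.
(* [u] is at most [d] on [L], by the choice of [k], and 2-Lipschitz. *)
have uL x : dist_fin L x < 4 * d -> `|u x| <= 9 * d.
  move=> Lx; have [|y yL xy] := dist_fin_lt _ Lx; first lra.
  have := kL _ yL; have := ub.2 x y.
  have := ler_normB (u x - u y) (g y - f k y).
  have -> : u x - u y - (g y - f k y) = u x by rewrite /u; ring.
  lra.
have T1 : `|T k (fun x => u x * (1 - a x))| <= M * (9 * d).
  apply: bndT => [|x]; first by apply: BLM => //; apply: BLB => //; exact: BL_cst.
  have [ge|lt] := lerP (4 * d) (dist_fin L x).
    rewrite /a far1 ?subrr ?mulr0 ?normr0//; last lra.
    by rewrite mulr_ge0// ltW.
  rewrite normrM; apply: le_trans (uL _ lt); rewrite ler_piMr//.
  by rewrite ger0_norm ?subr_ge0 ?far_le1// gerBl far_ge0.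
(* [u] is bounded by 2, whence the normalization by one half. *)
have T2 : `|T k (fun x => 2^-1 * (u x * a x * b x))| <= d.
  apply: FP => [|x|x Fx].
  - by apply: BLZ; apply: BLM => //; exact: BL_far.
  - rewrite !normrM ger0_norm ?invr_ge0// ler_pdivrMl// mulr1.
    rewrite -[leRHS]mulr1 -mulrA ler_pM ?mulr_ge0 ?ub.1//.
    by rewrite mulr_ile1// ger0_norm ?far_ge0 ?far_le1.
  - by rewrite /b far0 ?mulr0// ltW.
rewrite linZ// in T2; last by apply: BLM => //; exact: BL_far.
have E1 : T k u = T k (fun x => u x * (1 - a x)) + T k (fun x => u x * a x).
  rewrite -linD//; last by apply: BLM => //; apply: BLB => //; exact: BL_cst.
  by congr T; apply/funext => x; ring.
have E2 : T k (fun x => u x * a x) =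
    T k (fun x => u x * a x * b x) + T k (fun x => u x * a x * (1 - b x)).
  rewrite -linD//; [|by apply: BLM => //; exact: BL_far|exact: BLM].
  by congr T; apply/funext => x; ring.
have E3 : T k u = T k (f k) - T k g.
  by rewrite -linB//; exact: bounded_lip_BL (fb k).
have := Tf k; move: kg T1 T2; rewrite normrM ger0_norm ?invr_ge0//.
rewrite ltr_norml !ler_norml ler_pdivrMl//.
move=> /andP[_ g1] /andP[_ h1] h2 h3.
have := ler_norm (T k (fun x => u x * a x * b x)).
lra.
Qed.

(** Between points of the two supports the increment is at most [2 * C] while the
    distance is at least [d]. As neither bound deteriorates, humps can be summed
    indefinitely. *)
Lemma bounded_lip_disjointD (C Lam d : R) (A B : S -> R) :
  0 < d -> 0 <= C -> 2 * C / d <= Lam ->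
  bounded_lip C Lam A -> bounded_lip C Lam B ->
  (forall x y, A x != 0 -> B y != 0 -> d <= mdist x y) ->
  bounded_lip C Lam (fun x => A x + B x).
Proof.
move=> d0 C0 CL [AC AL] [BC BL'] AB; split=> [x|x y].
  have [->|A0] := eqVneq (A x) 0; first by rewrite add0r.
  have [->|B0] := eqVneq (B x) 0; first by rewrite addr0.
  by have := AB _ _ A0 B0; rewrite mdistxx leNgt d0.
have gap z t : A z != 0 -> B t != 0 -> `|A z - B t| <= Lam * mdist z t.
  move=> Az Bt; have dzt := AB _ _ Az Bt.
  apply: le_trans (_ : 2 * C <= _).
    by have := ler_normB (A z) (B t); have := AC z; have := BC t; lra.
  have CL2 : 2 * C <= Lam * d by rewrite -ler_pdivrMr.
  apply: (le_trans CL2); apply: ler_wpM2l => //.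
  by rewrite -(pmulr_lge0 _ d0); apply: (le_trans _ CL2); rewrite mulr_ge0.
have only_one z : A z != 0 -> B z = 0.
  by move=> Az; apply/eqP; apply: contraT => /(AB _ _ Az); rewrite mdistxx leNgt d0.
have [Ax|Ax] := eqVneq (A x) 0; have [Ay|Ay] := eqVneq (A y) 0.
- by rewrite Ax Ay !add0r.
- rewrite (only_one _ Ay) Ax add0r addr0.
  have [Bx|Bx] := eqVneq (B x) 0.
    by have := AL x y; rewrite Ax Bx.
  by rewrite distrC metric_sym gap.
- rewrite (only_one _ Ax) Ay add0r addr0.
  have [By|By] := eqVneq (B y) 0.
    by have := AL x y; rewrite Ay By.
  by rewrite gap.
- by rewrite (only_one _ Ax) (only_one _ Ay) !addr0.
Qed.

(** The sum of the humps is a single bounded Lipschitz function on which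
    infinitely many [T k] stay large. *)
Lemma no_humps (e : R) (f : nat -> S -> R) : 0 < e ->
  (forall k, bounded_lip 1 1 (f k)) -> ~ (forall k, e < T k (f k)).
Proof.
move=> e0 fb Tf.
have M0 : 0 <= M.
  have := bndT 0 (BL_cst 0) (fun _ => ltW (_ : `|0 : R| < 1)).
  by rewrite normr0 mulr1 => /(_ ltr01); apply: le_trans.
(* Each hump loses [(3 + 9 * M) * d] in [gliding_step], then [d] to the earlier humps
   and [4 * d] to the later ones; half of [e] must remain. *)
pose d := Num.min 4^-1 (e / (2 * (8 + 9 * M))).
have d0 : 0 < d by rewrite lt_min !invr_gt0 ltr0n divr_gt0//; lra.
have d4 : d <= 4^-1 by rewrite ge_min lexx.
have de : (8 + 9 * M) * d <= e / 2.
  have : d <= e / (2 * (8 + 9 * M)) by rewrite ge_min lexx orbT.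
  by rewrite ler_pdivlMr; lra.
pose P (s : nat * (seq S * (S -> R))) (t : nat * (seq S * (S -> R))) :=
  BL s.2.2 -> hump e d s.1 s.2.1 s.2.2 t.1 t.2.1 t.2.2.
have exP s : exists t, P s t.
  case: s => N [L H]; have [bH|bH] := pselect (BL H); last first.
    by exists (0, ([::], H)).
  have [k [F [h Ph]]] := gliding_step N L d0 d4 fb Tf bH.
  by exists (k, (F, h)).
have [phi phiP] := choice exP.
pose st := fix st j := if j is j'.+1 then
  let t := (phi (j', st j')).2 in
  ((st j').1 ++ t.1, fun x => (st j').2 x + t.2 x) else ([::], fun _ : S => 0 : R).
pose L j := (st j).1; pose H j := (st j).2.
pose k j := (phi (j, st j)).1; pose F j := (phi (j, st j)).2.1.
pose h j := (phi (j, st j)).2.2.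
have LS j x : dist_fin (L j.+1) x = Num.min (dist_fin (L j) x) (dist_fin (F j) x).
  by rewrite /L /= dist_fin_cat.
have step j : BL (H j) -> hump e d j (L j) (H j) (k j) (F j) (h j).
  exact: phiP (j, st j).
have Hb j : bounded_lip 2 (2 + 4 / d) (H j) /\
    forall x, H j x != 0 -> dist_fin (L j) x < 2 * d.
  elim: j => [|j [Hb HL]].
    split=> [|x]; last by rewrite /H /= eqxx.
    split=> [x|x y]; first by rewrite normr0.
    by rewrite subrr normr0 mulr_ge0 ?mdist_ge0// addr_ge0// divr_ge0// ltW.
  have [_ hb hF _ _] := step j (bounded_lip_BL Hb).
  split=> [|x].
    apply: (bounded_lip_disjointD d0 _ _ Hb hb) => //.
      by rewrite -natrM lerDr.
    move=> x y /HL Lx /hF[_ Ly]; have := dist_fin_lip (L j) y x.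
    have := ler_norm (dist_fin (L j) y - dist_fin (L j) x).
    by rewrite metric_sym; lra.
  rewrite LS gt_min (_ : H j.+1 x = H j x + h j x)//.
  have [->|/HL->//] := eqVneq (H j x) 0.
  by rewrite add0r => /hF[->]; rewrite orbT.
have bH j : BL (H j) := bounded_lip_BL (Hb j).1.
(* Near [L i] no hump is added after stage [i]. *)
have stable i j x : (i <= j)%N -> dist_fin (L i) x < 3 * d ->
    dist_fin (L j) x < 3 * d /\ H j x = H i x.
  move=> ij Lx; elim: j ij => [|j IH]; 
    first by rewrite leqn0 => /eqP i0; rewrite i0 in Lx *.
  rewrite leq_eqVlt => /orP[/eqP<-//|/IH[Lj Hj]].
  split; first by rewrite LS gt_min Lj.
  have [_ _ hF _ _] := step j (bH j).
  rewrite -Hj /H /= -/(H j) [X in _ + X](_ : _ = 0) ?addr0//.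
  by apply/eqP; apply: contraT => /hF[_]; lra.
(* At each point the partial sums are eventually constant: either some [L i] comes
   near the point, or no hump ever does. *)
have limH x : exists v, exists J, forall j, (J <= j)%N -> H j x = v.
  have [[i Li]|nL] := pselect (exists i, dist_fin (L i) x < 3 * d).
    by exists (H i x), i => j ij; have [] := stable _ _ _ ij Li.
  exists 0, 0%N => j _; apply/eqP; apply: contraT => /(Hb j).2 Lx.
  by exfalso; apply: nL; exists j; lra.
have [Hoo HooP] := choice limH.
have Hoob : bounded_lip 2 (2 + 4 / d) Hoo.
  split=> [x|x y].
    by have [J /(_ J (leqnn _))<-] := HooP x; exact: (Hb J).1.1.
  have [I HI] := HooP x; have [J HJ] := HooP y.
  rewrite -(HI (maxn I J)) ?leq_maxl// -(HJ (maxn I J)) ?leq_maxr//.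
  exact: (Hb _).1.2.
have bHoo := bounded_lip_BL Hoob.
have big j : e / 2 <= T (k j) Hoo.
  have [[_ TH] hb _ FP Th] := step j (bH j).
  have bh := bounded_lip_BL hb.
  (* The later humps vanish near [F j], where [T (k j)] is concentrated. *)
  have rest : `|T (k j) (fun x => 4^-1 * (Hoo x - H j.+1 x))| <= d.
    apply: FP => [|x|x Fx].
    - by apply: BLZ; exact: BLB.
    - rewrite normrM ger0_norm ?invr_ge0// ler_pdivrMl// mulr1.
      have := ler_normB (Hoo x) (H j.+1 x).
      by have := Hoob.1 x; have := (Hb j.+1).1.1 x; lra.
    - have [J HJ] := HooP x.
      rewrite -(HJ (maxn J j.+1)) ?leq_maxl//.
      have [||_ ->] := stable j.+1 (maxn J j.+1) x; first exact: leq_maxr.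
        by rewrite LS gt_min; apply/orP; right; lra.
      by rewrite subrr mulr0.
  rewrite linZ// in rest; last exact: BLB.
  have E : T (k j) Hoo = T (k j) (H j) + T (k j) (h j) +
      T (k j) (fun x => Hoo x - H j.+1 x).
    rewrite -linD// -linD//; [|exact: BLD|exact: BLB].
    by congr T; apply/funext => x; rewrite /H /= addrC subrK.
  move: rest TH; rewrite normrM ger0_norm ?invr_ge0// ler_pdivrMl//.
  by rewrite !ler_norml => /andP[? _] /andP[? _]; rewrite E; lra.
have /cvgrPdist_lt/(_ (e / 2)) := T0 bHoo.
case=> [|N _ NT]; first lra.
have [[Nk _] _ _ _ _] := step N (bH N).
have := NT _ Nk; rewrite /= sub0r normrN; have := big N.
have := ler_norm (T (k N) Hoo); lra.
Qed.

End gliding_hump.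

(** Weak convergence of tight functionals is uniform on the unit ball. A failure gives
    unit vectors on which the functionals of a subsequence exceed [e], after a change
    of sign, and [no_humps] excludes this. *)
Lemma schur {R : realType} {S : completeMetricType R} (M : R)
    (T : nat -> (S -> R) -> R) :
  (forall n, linear_on_BL (T n)) -> (forall n, bounded_by M (T n)) ->
  (forall n, tight (T n)) ->
  (forall f, BL f -> T n f @[n --> \oo] --> (0 : R)) ->
  forall e : R, 0 < e -> exists N, forall n, (N <= n)%N ->
  forall f, bounded_lip 1 1 f -> `|T n f| <= e.
Proof.
move=> linT bndT tightT T0 e e0; apply: contrapT => nT.
have bad N : exists p : nat * (S -> R),
    [/\ (N <= p.1)%N, bounded_lip 1 1 p.2 & e < T p.1 p.2].
  apply: contrapT => /forallNP np; apply: nT; exists N => n Nn f fb.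
  rewrite leNgt; apply/negP; rewrite ltr_normr => /orP[Tf|Tf].
    by apply: (np (n, f)).
  apply: (np (n, fun x => - f x)); split => //=.
    split=> [x|x y]; first by rewrite normrN fb.1.
    by rewrite opprK addrC distrC fb.2.
  by rewrite linN//; exact: bounded_lip_BL fb.
have [p pP] := choice bad.
pose T' k := T (p k).1.
have T'0 f : BL f -> T' n f @[n --> \oo] --> (0 : R).
  move=> bf; have poo : (p k).1 @[k --> \oo] --> \oo.
    move=> A [N _ NA]; exists N => // k /= Nk.
    by apply: NA => /=; apply: leq_trans Nk _; have [] := pP k.
  exact: (cvg_comp _ _ poo (T0 _ bf)).
apply: (@no_humps _ _ M T' _ _ _ T'0 e (fun k => (p k).2)) => //.
- by move=> n; exact: linT.
- by move=> n; exact: bndT.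
- by move=> n; exact: tightT.
- by move=> n; have [] := pP n.
- by move=> n; have [] := pP n.
Qed.

(** * Integrals of bounded Lipschitz functions *)

Section borel_integrals.
Context {R : realType} {S : completeMetricType R}.
Implicit Types f : S -> R.

Lemma BL_continuous f : BL f -> continuous f.
Proof.
move=> /BLP[C [L [_ L0 [_ fL]]]] x; apply/cvgrPdist_lt => e e0.
have r0 : 0 < e / (L + 1) by rewrite divr_gt0// ltr_wpDl.
apply/nbhs_ballP; exists (e / (L + 1)) => //= y.
rewrite ballEmdist /= ltr_pdivlMr ?ltr_wpDl// => xy.
apply: le_lt_trans (fL x y) (le_lt_trans _ xy).
by rewrite mulrC ler_wpM2l ?mdist_ge0// lerDl.
Qed.

Lemma BL_measurable f : BL f -> measurable_fun [set: Borel S] f.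
Proof.
move=> /BL_continuous/continuousP fc.
apply: (measurability _ (RGenOpens.measurableE R)) => _ [_ [a [b ->] <-]].
by rewrite setTI; apply: sub_sigma_algebra; exact/fc/interval_open.
Qed.

Lemma BL_integrable (p : {finite_measure set (Borel S) -> \bar R}) f :
  BL f -> p.-integrable setT (EFin \o f).
Proof.
move=> fb; apply: measurable_bounded_integrable => //.
- by rewrite ltey_eq fin_num_measure.
- exact: BL_measurable.
- exact: fb.1.
Qed.

Lemma linear_Rintegral (p : {finite_measure set (Borel S) -> \bar R}) :
  linear_on_BL (fun f => \int[p]_x f x).
Proof.
move=> a f g bf bg; rewrite RintegralD//; last 2 first.
- exact/BL_integrable/BLZ.
- exact/BL_integrable.
by rewrite RintegralZl//; exact/BL_integrable.
Qed.

Lemma bounded_Rintegral (p : {finite_measure set (Borel S) -> \bar R}) :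
  bounded_by (fine (p setT)) (fun f => \int[p]_x f x).
Proof.
move=> C f bf fC; have pf := BL_integrable p bf.
apply: le_trans (le_normr_Rintegral measurableT pf) _.
rewrite mulrC -Rintegral_cst//; apply: le_Rintegral => //.
  exact: (integrable_norm pf).
exact/BL_integrable/BL_cst.
Qed.

Lemma separable_dense_sequence : separable_space S ->
  exists s : nat -> S, forall x (e : R), 0 < e -> exists n, mdist x (s n) < e.
Proof.
move=> [D cD dD]; have := cD; rewrite /countable => /pfcard_geP[D0|[s]].
  have [x []] := dD setT (ex_intro _ point I) openT.
  by rewrite D0.
exists s => x e e0; have [|y [xy Dy]] := dD (ball x e)^° _ (@open_interior _ _).
  by exists x; exact: nbhsx_ballx.
have [n _ sny] := @surj _ _ _ _ s _ Dy; exists n; rewrite sny.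
by have := interior_subset xy; rewrite ballEmdist.
Qed.

(** The cutoffs of a dense sequence decrease to 0, so their integrals tend to 0. *)
Lemma tight_Rintegral (p : {finite_measure set (Borel S) -> \bar R}) :
  separable_space S -> tight (fun f => \int[p]_x f x).
Proof.
move=> /separable_dense_sequence[s sd] d e d0 e0.
pose F n := map s (iota 0 n).
pose w n := far (F n) 0 d.
have bw n : BL (w n) := BL_far _ _ d0.
have w0 x : w n x @[n --> \oo] --> (0 : R).
  apply/cvgrPdist_le => r r0; have rd : 0 < r * d by rewrite mulr_gt0.
  have [N xN] := sd x _ rd; exists N.+1 => // n /= Nn.
  have Dx : dist_fin (F n) x <= r * d.
    apply: le_trans (ltW xN); apply: dist_fin_le.
    by apply/mapP; exists N; rewrite // mem_iota.
  rewrite sub0r normrN ger0_norm ?far_ge0// /w /far subr0.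
  rewrite /clamp ge_max (ltW r0)/= ge_min; apply/orP; right.
  by rewrite ler_pdivrMr.
have i1 : p.-integrable setT (cst 1%E) := BL_integrable p (BL_cst 1).
have mw n : measurable_fun [set: Borel S] (EFin \o w n).
  by apply/measurable_EFinP; exact: BL_measurable.
have cw : {ae p, forall x, setT x -> (EFin \o w n) x @[n --> \oo] --> 0%E}.
  by apply: aeW => x _; apply: cvg_EFin; [exact: nearW|exact: w0].
have bw1 : {ae p, forall x n, setT x -> (`|(EFin \o w n) x| <= 1)%E}.
  by apply: aeW => x n _ /=; rewrite lee_fin ger0_norm ?far_ge0// far_le1.
have [_ _] := dominated_convergence measurableT mw (measurable_cst 0%E) cw i1 bw1.
rewrite integral0 => /fine_cvg/cvgrPdist_le/(_ _ e0)[N _ /(_ N (leqnn N)) /=].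
rewrite sub0r normrN => wN; exists (F N) => f bf f1 fF.
apply: le_trans wN; apply: le_trans (ler_norm _).
apply: le_trans (le_normr_Rintegral measurableT (BL_integrable p bf)) _.
apply: le_Rintegral => //.
- exact/(integrable_norm (BL_integrable p bf)).
- exact: BL_integrable.
- move=> x _; have [dx|xd] := lerP d (dist_fin (F N) x).
    by rewrite /w far1 ?add0r// f1.
  by rewrite fF// normr0 far_ge0.
Qed.

Lemma tightB (T1 T2 : (S -> R) -> R) : tight T1 -> tight T2 ->
  tight (fun f => T1 f - T2 f).
Proof.
move=> t1 t2 d e d0 e0; have e2 : 0 < e / 2 by lra.
have [F1 h1] := t1 _ _ d0 e2; have [F2 h2] := t2 _ _ d0 e2.
exists (F1 ++ F2) => f bf f1 fF.
have k1 : `|T1 f| <= e / 2.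
  by apply: h1 => // x xF; apply: fF; rewrite dist_fin_cat gt_min xF.
have k2 : `|T2 f| <= e / 2.
  by apply: h2 => // x xF; apply: fF; rewrite dist_fin_cat gt_min xF orbT.
have := ler_normB (T1 f) (T2 f); lra.
Qed.

Lemma bounded_byB (M1 M2 : R) (T1 T2 : (S -> R) -> R) : bounded_by M1 T1 ->
  bounded_by M2 T2 -> bounded_by (M1 + M2) (fun f => T1 f - T2 f).
Proof.
move=> b1 b2 C f bf fC; rewrite mulrDl (le_trans (ler_normB _ _))//.
by apply: lerD; [exact: b1|exact: b2].
Qed.

Lemma linear_on_BLB (T1 T2 : (S -> R) -> R) : linear_on_BL T1 ->
  linear_on_BL T2 -> linear_on_BL (fun f => T1 f - T2 f).
Proof. by move=> l1 l2 a f g bf bg; rewrite l1// l2//; ring. Qed.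

End borel_integrals.

Section pairing.
Context {R : realType} {S : completeMetricType R}.
Implicit Type mu : signed_measure R S.

Lemma linear_pairing mu : linear_on_BL (pairing mu).
Proof. by apply: linear_on_BLB; exact: linear_Rintegral. Qed.

Lemma tight_pairing mu : separable_space S -> tight (pairing mu).
Proof. by move=> sep; apply: tightB; exact: tight_Rintegral. Qed.

Lemma bounded_pairing mu (M : R) : (TV_norm mu <= M%:E)%E ->
  bounded_by M (pairing mu).
Proof.
move=> muM C f bf fC.
have C0 : 0 <= C by apply: le_trans (fC point).
apply: le_trans (bounded_byB (bounded_Rintegral (pos_part mu))
  (bounded_Rintegral (neg_part mu)) bf fC) _.
rewrite ler_wpM2r// -fineD ?fin_num_measure//.
by rewrite -lee_fin fineK// fin_numD !fin_num_measure.
Qed.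

Lemma finite_measure_fin (m : {finite_measure set (Borel S) -> \bar R}) A :
  measurable A -> exists a, m A = a%:E.
Proof. by move=> mA; exists (fine (m A)); rewrite fineK// fin_num_measure. Qed.

Lemma jordan_parts mu A : measurable A -> (mu A = pos_part mu A - neg_part mu A)%E.
Proof.
move=> mA; rewrite {1}(jordan_decomp (hahn_choice mu) mA).
by rewrite /cadd /= cscaleN1.
Qed.

Lemma finite_measure_add (p q : {finite_measure set (Borel S) -> \bar R}) :
  exists r : {finite_measure set (Borel S) -> \bar R},
    (forall A, r A = p A + q A)%E /\
    forall f, BL f -> \int[r]_x f x = \int[p]_x f x + \int[q]_x f x.
Proof.
pose s : {measure set (Borel S) -> \bar R} := measure_add p q.
have fin : fin_num_fun s.
  move=> A mA; rewrite [s A](_ : _ = p A + q A)%E; last exact: measure_addE.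
  by rewrite fin_numD !fin_num_measure.
pose r : {finite_measure set (Borel S) -> \bar R} := HB.pack
  (s : set (Borel S) -> \bar R) (Measure.class s)
  (Measure_isFinite.Build _ (Borel S) R s fin).
exists r; split=> [A|f bf]; first exact: measure_addE.
rewrite /Rintegral -fineD; try exact: integrable_fin_num (BL_integrable _ bf).
congr fine; exact: (integral_measure_add measurableT (BL_integrable p bf)
  (BL_integrable q bf)).
Qed.

(** If [p - q] and [p' - q'] agree, then so do [p + q'] and [p' + q], which are
    measures; hence the choice of a decomposition does not matter. *)
Lemma pairing_difference mu (p q : {finite_measure set (Borel S) -> \bar R}) f :
  BL f -> (forall A, measurable A -> mu A = p A - q A)%E ->
  pairing mu f = \int[p]_x f x - \int[q]_x f x.
Proof.
move=> bf muE; rewrite /pairing; set P := pos_part mu; set N := neg_part mu.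
have [r [rE rI]] := finite_measure_add P q.
have [r' [r'E r'I]] := finite_measure_add p N.
have : \int[r]_x f x = \int[r']_x f x.
  congr fine; apply: eq_measure_integral => A mA _.
  apply: etrans (rE A) (etrans _ (esym (r'E A))).
  have := muE _ mA; rewrite (jordan_parts mu mA) -/P -/N.
  have [[a ->] [b ->]] := (finite_measure_fin P mA, finite_measure_fin N mA).
  have [[a' ->] [b' ->]] := (finite_measure_fin p mA, finite_measure_fin q mA).
  by move=> -[h]; congr EFin; lra.
by rewrite rI// r'I// => sums; lra.
Qed.

Lemma pairingB mu nu f : BL f ->
  pairing (cadd mu (copp nu)) f = pairing mu f - pairing nu f.
Proof.
move=> bf; have [p [pE pI]] := finite_measure_add (pos_part mu) (neg_part nu).
have [q [qE qI]] := finite_measure_add (neg_part mu) (pos_part nu).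
rewrite (pairing_difference (p := p) (q := q) bf); last first.
  move=> A mA; rewrite pE qE.
  transitivity (mu A - nu A)%E => //.
  rewrite (jordan_parts mu mA) (jordan_parts nu mA).
  have [a ->] := finite_measure_fin (pos_part mu) mA.
  have [b ->] := finite_measure_fin (neg_part mu) mA.
  have [c ->] := finite_measure_fin (pos_part nu) mA.
  have [e ->] := finite_measure_fin (neg_part nu) mA.
  by congr EFin; ring.
by rewrite pI// qI// /pairing; ring.
Qed.

End pairing.

(** * The limit functional *)

Section limit_functional.
Context {R : realType} {S : completeMetricType R}.
Implicit Types f : S -> R.

(** Weaker than [tight]: the finite set may depend on the Lipschitz constant. This is
    what survives passage to the limit in the dual norm. *)
Definition lip_tight (T : (S -> R) -> R) := forall d e L : R,
  0 < d -> 0 < e -> 0 <= L -> exists F : seq S, forall f, bounded_lip 1 L f ->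
    (forall x, dist_fin F x < d -> f x = 0) -> `|T f| <= e.

Variables (M : R) (T : nat -> (S -> R) -> R).
Hypothesis linT : forall n, linear_on_BL (T n).
Hypothesis bndT : forall n, bounded_by M (T n).
Hypothesis tightT : forall n, tight (T n).
Hypothesis cvgT : forall f, BL f -> cvg (T n f @[n --> \oo]).

Let phi f := lim (T n f @[n --> \oo]).

Lemma linear_lim : linear_on_BL phi.
Proof.
move=> a f g bf bg; apply: cvg_lim => //.
under eq_fun do rewrite linT//.
by apply: cvgD; [apply: cvgMl_tmp|]; exact: cvgT.
Qed.

Let near_lim f (e : R) : BL f -> 0 < e ->
  exists N, forall n, (N <= n)%N -> `|phi f - T n f| <= e.
Proof.
by move=> bf e0; have /cvgrPdist_le/(_ _ e0)[N _ NT] := cvgT bf; exists N.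
Qed.

Lemma bounded_lim : bounded_by M phi.
Proof.
move=> C f bf fC; apply/ler_addgt0Pr => e e0.
have [N /(_ N (leqnn N)) TN] := near_lim bf e0.
have := bndT N bf fC; have := ler_normD (phi f - T N f) (T N f).
by rewrite subrK; lra.
Qed.

(** If the Cauchy criterion failed uniformly on the unit ball, it would fail along two
    subsequences, whose differences are subject to the Schur property. *)
Lemma cauchy_dual (e : R) : 0 < e -> exists N, forall n m,
  (N <= n)%N -> (N <= m)%N -> forall f, bounded_lip 1 1 f ->
  `|T n f - T m f| <= e.
Proof.
move=> e0; apply: contrapT => nT.
have bad N : exists p : nat * nat, [/\ (N <= p.1)%N, (N <= p.2)%N &
    exists2 f, bounded_lip 1 1 f & e < `|T p.1 f - T p.2 f|].
  apply: contrapT => /forallNP np; apply: nT; exists N => n m Nn Nm f fb.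
  by rewrite leNgt; apply/negP => Tf; apply: (np (n, m)); split => //; exists f.
have [p pP] := choice bad.
have [||||N NP] := @schur R S (M + M)
    (fun k f => T (p k).1 f - T (p k).2 f) _ _ _ _ _ e0.
- by move=> k; apply: linear_on_BLB.
- by move=> k; apply: bounded_byB.
- by move=> k; apply: tightB.
- move=> f bf; apply/cvgrPdist_le => r r0; have r2 : 0 < r / 2 by lra.
  have [K KT] := near_lim bf r2; exists K => // k /= Kk.
  have [pk1 pk2 _] := pP k; have := KT _ (leq_trans Kk pk1).
  have := KT _ (leq_trans Kk pk2); rewrite sub0r normrN.
  have -> : T (p k).1 f - T (p k).2 f =
    (phi f - T (p k).2 f) - (phi f - T (p k).1 f) by ring.
  have := ler_normB (phi f - T (p k).2 f) (phi f - T (p k).1 f); lra.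
have [_ _ [f fb]] := pP N.
by rewrite ltNge (NP N).
Qed.

Lemma cvg_dual (e : R) : 0 < e -> exists N, forall n, (N <= n)%N ->
  forall f, bounded_lip 1 1 f -> `|T n f - phi f| <= e.
Proof.
move=> e0; have [N NT] := cauchy_dual e0; exists N => n Nn f fb.
apply/ler_addgt0Pr => r r0.
have [K KT] := near_lim (bounded_lip_BL fb) r0.
have := KT _ (leq_maxr N K); have := NT _ _ Nn (leq_maxl N K) f fb.
set m := maxn N K.
have -> : T n f - phi f = (T n f - T m f) - (phi f - T m f) by ring.
have := ler_normB (T n f - T m f) (phi f - T m f); lra.
Qed.

Lemma lip_tight_lim : lip_tight phi.
Proof.
move=> d e L d0 e0 L0; have c0 : 0 < 1 + L by lra.
have e2 : 0 < e / 2 by lra.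
have [N /(_ N (leqnn N)) NT] := cvg_dual (divr_gt0 e2 c0).
have [F FT] := tightT N d0 e2; exists F => f fb fF.
have bf := bounded_lip_BL fb; have [f1 fL] := fb.
have fT := FT f bf f1 fF.
have ci0 : 0 <= (1 + L)^-1 by rewrite invr_ge0 ltW.
have cfb : bounded_lip 1 1 (fun x => (1 + L)^-1 * f x).
  split=> [x|x y]; rewrite -?mulrBr normrM (ger0_norm ci0).
    by rewrite ler_pdivrMl// mulr1 (le_trans (f1 x))// lerDl.
  rewrite mul1r ler_pdivrMl// (le_trans (fL x y))// ler_wpM2r ?mdist_ge0//; lra.
have := NT _ cfb; rewrite linZ// (linZ linear_lim)// -mulrBr normrM (ger0_norm ci0).
rewrite mulrC ler_pM2r ?invr_gt0// => Tphi.
have := ler_normB (T N f) (T N f - phi f); rewrite subKr; lra.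
Qed.

End limit_functional.

(** * The positive part of a functional *)

Section positive_part.
Context {R : realType} {S : completeMetricType R}.
Implicit Types f g : S -> R.

(** The properties of a positive functional from which a measure can be constructed.
    In contrast with [lip_tight], the smallness near infinity is uniform over all
    Lipschitz constants. *)
Definition positive_tight (psi : (S -> R) -> R) : Prop :=
  [/\ forall f g, BL f -> BL g -> (forall x, 0 <= f x) -> (forall x, 0 <= g x) ->
        psi (fun x => f x + g x) = psi f + psi g,
      forall f, BL f -> (forall x, 0 <= f x) -> 0 <= psi f &
      forall d e : R, 0 < d -> 0 < e -> exists F : seq S, forall f, BL f ->
        (forall x, 0 <= f x <= 1) -> (forall x, dist_fin F x < d -> f x = 0) ->
        psi f <= e].

Definition below f : set (S -> R) := [set g | BL g /\ forall x, 0 <= g x <= f x].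

(** The positive part of a functional in the sense of Riesz, meaningful on
    nonnegative functions. *)
Definition fun_pos (phi : (S -> R) -> R) f : R := sup [set phi g | g in below f].

Variables (M : R) (phi : (S -> R) -> R).
Hypothesis linphi : linear_on_BL phi.
Hypothesis bndphi : bounded_by M phi.
Hypothesis tightphi : lip_tight phi.

Let psi := fun_pos phi.

Let below0 f : (forall x, 0 <= f x) -> below f (fun=> 0).
Proof. by move=> f0; split=> [|x]; [exact: BL_cst|rewrite lexx f0]. Qed.

Lemma fun_pos_le f (B : R) : (forall x, 0 <= f x) ->
  (forall g, below f g -> phi g <= B) -> psi f <= B.
Proof.
move=> f0 fB; apply: ge_sup.
  by exists (phi (fun=> 0)), (fun=> 0) => //; exact: below0.
by move=> _ [g gf <-]; exact: fB.
Qed.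

Lemma fun_pos_ge f g : BL f -> below f g -> phi g <= psi f.
Proof.
move=> bf gf; apply: sup_ubound; last by exists g.
have [C [L [C0 _ [fC _]]]] := (BLP f).1 bf.
exists (M * C) => _ [h [bh hf] <-].
apply: le_trans (ler_norm _) (bndphi bh _) => x.
have /andP[h0 hfx] := hf x; rewrite ger0_norm// (le_trans hfx)//.
exact: le_trans (ler_norm _) (fC x).
Qed.

Lemma fun_pos_ge0 f : BL f -> (forall x, 0 <= f x) -> 0 <= psi f.
Proof. by move=> bf f0; rewrite -(lin0 linphi); apply/fun_pos_ge/below0. Qed.

(** Additivity is the Riesz decomposition property: [g <= f1 + f2] splits as
    [min g f1] plus a function below [f2]. *)
Lemma fun_posD f1 f2 : BL f1 -> BL f2 ->
  (forall x, 0 <= f1 x) -> (forall x, 0 <= f2 x) ->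
  psi (fun x => f1 x + f2 x) = psi f1 + psi f2.
Proof.
move=> b1 b2 p1 p2; have bs := BLD b1 b2.
apply/eqP; rewrite eq_le; apply/andP; split.
  apply: fun_pos_le => [x|g [bg gf]]; first by rewrite addr_ge0.
  have bm := BL_min bg b1.
  have -> : phi g = phi (fun x => Num.min (g x) (f1 x)) +
      phi (fun x => g x - Num.min (g x) (f1 x)).
    by rewrite (linB linphi)// addrC subrK.
  apply: lerD; apply: fun_pos_ge => //; split=> //.
  - by move=> x; have /andP[g0 _] := gf x; rewrite le_min ge_min g0 p1 lexx orbT.
  - exact: BLB.
  - move=> x; have /andP[g0 gx] := gf x; rewrite subr_ge0 ge_min lexx/=.
    by have := p2 x; case: (lerP (g x) (f1 x)); lra.
rewrite -lerBrDr; apply: fun_pos_le => // g1 [bg1 g1f].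
rewrite lerBrDr addrC -lerBrDr; apply: fun_pos_le => // g2 [bg2 g2f].
rewrite lerBrDr addrC -(linD linphi)//; apply: fun_pos_ge => //; split.
  exact: BLD.
move=> x; have /andP[g10 g11] := g1f x; have /andP[g20 g21] := g2f x.
by rewrite addr_ge0// lerD.
Qed.

(** If this failed, disjoint neighbourhoods of finite sets would successively carry
    functions on which [phi] exceeds a fixed threshold, while their sum is still
    bounded by 1. *)
Lemma fun_pos_tight (d e : R) : 0 < d -> 0 < e -> exists F : seq S, forall f,
  BL f -> (forall x, 0 <= f x <= 1) ->
  (forall x, dist_fin F x < d -> f x = 0) -> psi f <= e.
Proof.
move=> d0 e0; apply: contrapT => /forallNP nF.
have bad F : exists g, [/\ BL g, forall x, 0 <= g x <= 1,
    forall x, dist_fin F x < d -> g x = 0 & e < phi g].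
  apply: contrapT => ng; apply: (nF F) => f bf f01 fF.
  have f0 x : 0 <= f x by have /andP[] := f01 x.
  apply: fun_pos_le => // g [bg gf]; rewrite leNgt; apply/negP => eg.
  apply: ng; exists g; split=> // x.
    have /andP[g0 gx] := gf x; have /andP[_ f1] := f01 x.
    by rewrite g0 (le_trans gx).
  by move=> xF; apply/eqP; have := gf x; rewrite fF// -eq_le eq_sym.
have d2 : 0 < d / 2 by lra.
have e2 : 0 < e / 2 by lra.
(* [N] disjointly supported pieces, each contributing at least [e / 2]. *)
have pile N : exists F g, [/\ BL g, forall x, 0 <= g x <= 1,
    forall x, g x != 0 -> dist_fin F x < d & N%:R * (e / 2) <= phi g].
  elim: N => [|N [F [g [bg g01 gF gN]]]].
    exists [::], (fun=> 0); split=> [|x|x|]; first exact: BL_cst.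
    - by rewrite lexx ler01.
    - by rewrite eqxx.
    - by rewrite mul0r (lin0 linphi).
  have [h [bh h01 hF eh]] := bad F.
  have [C [L [C0 L0 [_ hL]]]] := (BLP h).1 bh.
  have hb : bounded_lip 1 L h.
    by split=> // x; have /andP[? ?] := h01 x; rewrite ger0_norm.
  have i0 : 0 <= (d / 2)^-1 by rewrite invr_ge0 ltW.
  have L'0 : 0 <= L * 1 + 1 * (d / 2)^-1 by lra.
  (* [h] need not be concentrated near a finite set, but by tightness its part far
     from a suitable [G] contributes at most [e / 2] and can be removed. *)
  have [G GP] := tightphi d2 e2 L'0.
  pose c := far G (d / 2) (d / 2).
  have bc : BL c := BL_far _ _ d2.
  have hc : `|phi (fun x => h x * c x)| <= e / 2.
    apply: GP => [|x xG]; last by rewrite /c far0 ?mulr0// ltW.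
    have := bounded_lipM ler01 ler01 L0 i0 hb (bounded_lip_far G (d / 2) d2).
    by rewrite !mulr1.
  have bhc := BLM bh bc.
  exists (F ++ G), (fun x => g x + (h x - h x * c x)).
  have c01 x : 0 <= c x <= 1 by rewrite far_ge0 far_le1.
  have h'01 x : 0 <= h x - h x * c x <= h x.
    have /andP[? ?] := c01 x; have /andP[? ?] := h01 x; apply/andP; split; nra.
  split.
  - exact/BLD/BLB.
  - move=> x; have [gx|gx] := eqVneq (g x) 0.
      have /andP[? ?] := h'01 x; have /andP[? ?] := h01 x.
      by rewrite gx add0r; apply/andP; split; lra.
    by rewrite (hF x) ?gF// mul0r subrr addr0.
  - move=> x; rewrite dist_fin_cat gt_min; have [gx|/gF->//] := eqVneq (g x) 0.
    rewrite gx add0r; case: (ltP (dist_fin G x) d); rewrite ?orbT// => xG.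
    by rewrite /c far1 ?mulr1 ?subrr ?eqxx//; lra.
  - rewrite (linD linphi)//; last exact: BLB.
    rewrite (linB linphi)//.
    by have := ler_norm (phi (fun x => h x * c x)); rewrite -natr1; lra.
have [N NM] : exists N : nat, M < N%:R * (e / 2).
  exists (Num.truncn (M / (e / 2))).+1; rewrite -ltr_pdivrMr//.
  exact: truncnS_gt.
have [F [g [bg g01 _]]] := pile N.
have g1 x : `|g x| <= 1 by have /andP[? ?] := g01 x; rewrite ger0_norm.
have := bndphi bg g1; have := ler_norm (phi g); lra.
Qed.

Lemma positive_tight_fun_pos : positive_tight psi.
Proof.
split; [exact: fun_posD|exact: fun_pos_ge0|exact: fun_pos_tight].
Qed.

End positive_part.

Section jordan_functional.
Context {R : realType} {S : completeMetricType R}.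

(** The map [g |-> f - g] exchanges the two suprema. *)
Lemma fun_pos_sub (M : R) (phi : (S -> R) -> R) f : linear_on_BL phi ->
  bounded_by M phi -> BL f -> (forall x, 0 <= f x) ->
  phi f = fun_pos phi f - fun_pos (fun g => - phi g) f.
Proof.
move=> linphi bndphi bf f0.
have linN : linear_on_BL (fun g => - phi g).
  by move=> a g h bg bh; rewrite linphi//; ring.
have bndN : bounded_by M (fun g => - phi g).
  by move=> C g bg gC; rewrite normrN; exact: bndphi.
have compl g : below f g -> below f (fun x => f x - g x).
  move=> [bg gf]; split=> [|x]; first exact: BLB.
  by have /andP[g0 gx] := gf x; rewrite subr_ge0 gx gerBl.
apply/eqP; rewrite eq_le; apply/andP; split.
  rewrite lerBrDr -lerBrDl; apply: fun_pos_le => // g gf.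
  have := fun_pos_ge bndphi bf (compl _ gf).
  by rewrite (linB linphi)//; [lra|exact: gf.1].
rewrite lerBlDr; apply: fun_pos_le => // g gf.
have := fun_pos_ge bndN bf (compl _ gf).
by rewrite (linB linphi)//; [lra|exact: gf.1].
Qed.

End jordan_functional.

(** * The Daniell property *)

Section positive_functionals.
Context {R : realType} {S : completeMetricType R}.
Implicit Types f g : S -> R.
Variable psi : (S -> R) -> R.
Hypothesis psiP : positive_tight psi.

Let psi_add f g : BL f -> BL g -> (forall x, 0 <= f x) -> (forall x, 0 <= g x) ->
  psi (fun x => f x + g x) = psi f + psi g.
Proof. by case: psiP => + _ _; exact. Qed.

Lemma pos_ge0 f : BL f -> (forall x, 0 <= f x) -> 0 <= psi f.
Proof. by case: psiP => _ + _; exact. Qed.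

Lemma pos_le f g : BL f -> BL g -> (forall x, 0 <= f x <= g x) -> psi f <= psi g.
Proof.
move=> bf bg fg.
have f0 x : 0 <= f x by have /andP[] := fg x.
have d0 x : 0 <= g x - f x by have /andP[_] := fg x; rewrite subr_ge0.
have -> : psi g = psi f + psi (fun x => g x - f x).
  rewrite -psi_add//; last exact: BLB.
  by congr psi; apply/funext => x; rewrite addrC subrK.
by rewrite lerDl; apply: pos_ge0 => //; exact: BLB.
Qed.

Lemma pos0 : psi (fun=> 0) = 0.
Proof.
have := psi_add (BL_cst 0) (BL_cst 0) (fun=> lexx 0) (fun=> lexx 0).
have -> : (fun _ : S => 0 + 0 : R) = fun=> 0 by apply/funext => x; rewrite addr0.
lra.
Qed.

Lemma pos_sum (g : nat -> S -> R) n : (forall k, BL (g k)) ->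
  (forall k x, 0 <= g k x) ->
  psi (fun x => \sum_(k < n) g k x) = \sum_(k < n) psi (g k).
Proof.
move=> bg g0; elim: n => [|n IH].
  rewrite big_ord0 -[RHS]pos0; congr psi; apply/funext => x.
  by rewrite big_ord0.
rewrite big_ord_recr/= -IH -psi_add//; last 2 first.
- exact: BL_sum.
- by move=> x; exact: sumr_ge0.
by congr psi; apply/funext => x; rewrite big_ord_recr.
Qed.

Lemma pos_mulrn f n : BL f -> (forall x, 0 <= f x) ->
  psi (fun x => n%:R * f x) = n%:R * psi f.
Proof.
move=> bf f0; rewrite mulr_natl -[n in RHS]card_ord -sumr_const.
rewrite -(@pos_sum (fun=> f))//; congr psi; apply/funext => x.
by rewrite sumr_const card_ord mulr_natl.
Qed.

(** Along an ultrafilter, one of the finitely many balls of each scale contains almost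
    all of the sequence, which is therefore Cauchy. *)
Lemma near_finite_sets_cluster (x_ : nat -> S) (F : nat -> seq S) (r : nat -> R)
    (U : set_system nat) : UltraFilter U -> \oo `<=` U ->
  (forall e, 0 < e -> exists m, r m <= e) ->
  (forall m n, (m < n)%N -> exists2 y, y \in F m & mdist (x_ n) y < r m) ->
  cvg (x_ @ U).
Proof.
move=> UU Uoo r0 xF.
have near_y m : exists y, \forall n \near U, mdist (x_ n) y < r m.
  apply: contrapT => /forallNP ny.
  have : \forall n \near U, forall y, y \in F m -> ~ mdist (x_ n) y < r m.
    elim: (F m) => [|y s IH]; first by near=> n.
    have [/ny//|Uy] := in_ultra_setVsetC [set n | mdist (x_ n) y < r m] UU.
    by apply: filterS (filterI Uy IH) => n [? IHn] z;
      rewrite inE => /orP[/eqP->|/IHn].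
  move=> Um; have [n [nm ny']] := filter_ex (filterI (Uoo _ (nbhs_infty_gt m)) Um).
  by have [y yF xy] := xF _ _ nm; exact: (ny' y).
have : cauchy_ex (x_ @ U).
  move=> e e0; have [m rm] := r0 _ e0; have [y Uy] := near_y m; exists y.
  apply: filterS Uy => n /= xy.
  by rewrite ballEmdist /= metric_sym (lt_le_trans xy).
by move=> /cauchy_exP/cauchy_cvgP.
Unshelve. all: by end_near. Qed.

(** The Daniell property, for covers of the whole space. The truncated remainders
    [h n] decrease to 0 pointwise. Let [A n] be the set of points near the finite sets
    [F m], [m < n], at scales decreasing to 0. If [h n] exceeded [1 / K] at a point of
    [A n] for all [n], these points would cluster, and no [h n] would be less than
    [1 / K] at the limit. So [h n <= 1 / K] on some [A n], and tightness controls
    [psi] off [A n]. *)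
Lemma pos_daniell (g : nat -> S -> R) (e : R) : (forall k, BL (g k)) ->
  (forall k x, 0 <= g k x) ->
  (forall x (r : R), 0 < r -> exists n, 1 - r < \sum_(k < n) g k x) ->
  0 < e -> exists n, psi (fun=> 1) <= \sum_(k < n) psi (g k) + e.
Proof.
move=> bg g0 g1 e0; have e2 : 0 < e / 2 by lra.
have b1 : BL (fun _ : S => 1 : R) := BL_cst 1.
pose h n x := Num.max 0 (1 - \sum_(k < n) g k x).
have bh n : BL (h n) by apply: BL_max0; apply: BLB => //; exact: BL_sum.
have h0 n x : 0 <= h n x by rewrite le_max lexx.
have h1 n x : h n x <= 1.
  by rewrite ge_max ler01 gerBl sumr_ge0.
have h_le m n x : (m <= n)%N -> h n x <= h m x.
  move=> mn; rewrite ge_max le_max lexx/= le_max; apply/orP; right.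
  rewrite lerB// -(subnKC mn) big_split_ord/= lerDl.
  exact: sumr_ge0.
have psih n : psi (fun=> 1) <= \sum_(k < n) psi (g k) + psi (h n).
  rewrite -pos_sum// -psi_add//; last by move=> x; exact: sumr_ge0.
    apply: pos_le => [//||x]; first by apply: BLD => //; exact: BL_sum.
    rewrite ler01/= -lerBlDl.
    by rewrite le_max lexx orbT.
  exact: BL_sum.
suff [n hn] : exists n, psi (h n) <= e.
  by exists n; have := psih n; lra.
(* [psi] is only known to be homogeneous for integers, so the uniform bound on [h n]
   is taken of the form [1 / K]. *)
have [K K0 eK] : exists2 K : nat, (0 < K)%N & psi (fun=> 1) <= K%:R * (e / 2).
  exists (Num.truncn (psi (fun=> 1) / (e / 2))).+1 => //.
  by rewrite -ler_pdivrMr//; apply/ltW; exact: truncnS_gt.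
have K0' : 0 < K%:R :> R by rewrite ltr0n.
have iK : (0 : R) < K%:R^-1 by rewrite invr_gt0.
pose d m : R := 2^-1 / m.+1%:R.
have d0 m : 0 < d m by rewrite divr_gt0// invr_gt0.
have exF m : exists F : seq S, forall f, BL f -> (forall x, 0 <= f x <= 1) ->
    (forall x, dist_fin F x < d m -> f x = 0) -> psi f <= e / 2 / 2 ^+ m.+1.
  by case: psiP => _ _; apply => //; rewrite divr_gt0// exprn_gt0.
have [F FP] := choice exF.
pose chi m := far (F m) (d m) (d m).
have bchi m : BL (chi m) := BL_far _ _ (d0 m).
have psichi m : psi (chi m) <= e / 2 / 2 ^+ m.+1.
  apply: FP => // x; first by rewrite far_ge0 far_le1.
  by move=> xF; rewrite /chi far0// ltW.
have [n hn] : exists n, forall x, (forall m, (m < n)%N ->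
    dist_fin (F m) x < d m + d m) -> h n x <= K%:R^-1.
  apply: contrapT => /forallNP nh.
  have bad n : exists x, (forall m, (m < n)%N -> dist_fin (F m) x < d m + d m) /\
      K%:R^-1 < h n x.
    apply: contrapT => /forallNP nx; apply: (nh n) => x xF.
    by rewrite leNgt; apply/negP => hx; apply: (nx x).
  have [x_ xP] := choice bad.
  have [U [UU Uoo]] := @ultraFilterLemma nat \oo _.
  have dd m : d m + d m = m.+1%:R^-1.
    by rewrite /d -mulrDl (_ : 2^-1 + 2^-1 = 1) ?mul1r//; lra.
  have /cvg_ex[z xz] : cvg (x_ @ U).
    apply: (@near_finite_sets_cluster _ F (fun m => d m + d m)) => //.
      move=> r r0; exists (Num.truncn r^-1).
      rewrite dd -[leRHS]invrK lef_pV2 ?posrE ?invr_gt0//.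
      by apply/ltW; exact: truncnS_gt.
    move=> m n mn; apply: dist_fin_lt; last exact: (xP n).1.
    by rewrite dd invf_le1// ler1n.
  have [n nz] := g1 z _ iK.
  have : h n z < K%:R^-1 by rewrite gt_max iK/=; lra.
  apply/negP; rewrite -leNgt.
  have hz : h n (x_ k) @[k --> U] --> h n z.
    by apply: continuous_cvg xz; exact: BL_continuous.
  apply: (cvgr_to_ge hz).
  apply: Uoo; exists n => // k /= nk.
  by apply: le_trans (ltW (xP k).2) (h_le _ _ _ nk).
exists n.
have bs : BL (fun x => \sum_(m < n) chi m x) by exact: BL_sum.
have s0 x : 0 <= \sum_(m < n) chi m x.
  by apply: sumr_ge0 => m _; exact: far_ge0.
have hle x : h n x <= K%:R^-1 + \sum_(m < n) chi m x.
  have [xF|] := pselect (forall m, (m < n)%N -> dist_fin (F m) x < d m + d m).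
    by rewrite (le_trans (hn _ xF))// lerDl.
  move=> /existsNP[m /not_implyP[mn /negP]]; rewrite -leNgt => xF.
  rewrite (le_trans (h1 n x))// (bigD1 (Ordinal mn))//= {1}/chi far1//.
  rewrite addrCA lerDl addr_ge0 ?(ltW iK)//.
  by apply: sumr_ge0 => i _; exact: far_ge0.
have K1 : psi (fun=> K%:R^-1) <= e / 2.
  have i0 : 0 <= K%:R^-1 :> R by rewrite invr_ge0 ltW.
  have := pos_mulrn K (BL_cst (K%:R^-1)) (fun=> i0).
  rewrite (_ : (fun _ => _) = fun=> 1); last first.
    by apply/funext => x; rewrite mulfV// gt_eqF.
  by move=> E; rewrite E ler_pM2l// in eK.
have sume : \sum_(m < n) psi (chi m) <= e / 2.
  apply: (@le_trans _ _ (\sum_(m < n) (e / 2 / 2 ^+ m.+1))).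
    by apply: ler_sum => m _; exact: psichi.
  have -> : \sum_(m < n) (e / 2 / 2 ^+ m.+1) = e / 2 - e / 2 / 2 ^+ n.
    elim: n {hn bs s0 hle} => [|n IH]; first by rewrite big_ord0 expr0; lra.
    rewrite big_ord_recr/= IH exprS.
    by field; rewrite expf_neq0.
  by rewrite gerBl divr_ge0 ?exprn_ge0// ltW.
apply: (@le_trans _ _ (psi (fun x => K%:R^-1 + \sum_(m < n) chi m x))).
  apply: pos_le => // [|x]; last by rewrite h0 hle.
  by apply: BLD => //; exact: BL_cst.
rewrite psi_add ?(ltW iK)//; last exact: BL_cst.
rewrite pos_sum//; last by move=> k x; exact: far_ge0.
lra.
Qed.

End positive_functionals.

(** * The measure of a positive functional *)

(** Unfolding a double series along an enumeration of pairs; one enumeration serves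
    all nonnegative double sequences. *)
Lemma nneseries_pairing {R : realType} : exists f : nat -> nat * nat,
  forall a : nat -> nat -> \bar R, (forall i j, 0 <= a i j)%E ->
  (\sum_(k <oo) a (f k).1 (f k).2 = \sum_(i <oo) \sum_(j <oo) a i j)%E.
Proof.
have /card_esym/ppcard_eqP[f] := card_nat2.
exists f => a a0; pose b := uncurry a.
have b0 x : (0 <= b x)%E by case: x => i j; exact: a0.
transitivity (\esum_(i in [set: nat * nat]) b i)%E.
  transitivity (\sum_(k <oo) b (f k))%E.
    by apply: eq_eseriesr => k _; rewrite /b; case: (f k).
  rewrite -(esum_pred_image b f xpredT) ?[fun=> _]set_true//.
  by rewrite image_eq.
pose J : nat -> set (nat * nat) := fun i => [set (i, j) | j in setT].
rewrite (_ : setT = \bigcup_k J k); last first.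
  by rewrite predeqE => -[i j]; split => // _; exists i => //; exists j.
rewrite esum_bigcupT//; last first.
  apply/trivIsetP => i j _ _ ij.
  rewrite predeqE => -[n m] /=; split => //= -[] [_] _ [<-{n} _].
  by move=> [m' _] [] /esym/eqP; rewrite (negbTE ij).
rewrite -(image_id [set: nat]) -fun_true esum_pred_image//; last first.
  by move=> n _; exact: esum_ge0.
apply: eq_eseriesr => /= j _.
rewrite -(esum_pred_image b (pair j) predT)//=; last first.
  by move=> ? ? _ _; exact: (@can_inj _ _ _ snd).
by congr esum; rewrite predeqE => -[i k]; split; move=> [m _ <-]; exists m.
Qed.

Lemma nneseries_term {R : realType} (u : nat -> \bar R) n :
  (forall k, 0 <= u k)%E -> (u n <= \sum_(k <oo) u k)%E.
Proof.
move=> u0; apply: le_trans (nneseries_lim_ge n.+1 _) => //.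
by rewrite big_mkord big_ord_recr/= leeDr// sume_ge0.
Qed.

Lemma eseries_first {R : realType} (u : nat -> \bar R) :
  (forall k, u k.+1 = 0)%E -> (\sum_(k <oo) u k = u 0%N)%E.
Proof.
move=> u0; apply: lim_near_cst => //; near=> n.
have n0 : (0 < n)%N by near: n; exact: nbhs_infty_gt.
by rewrite -(prednK n0) big_nat_recl//= big1 ?adde0.
Unshelve. all: by end_near. Qed.

Section measure_of_functional.
Context {R : realType} {S : completeMetricType R}.
Implicit Types (f : S -> R) (g : nat -> S -> R) (A X : set S).
Variable psi : (S -> R) -> R.
Hypothesis psiP : positive_tight psi.

Definition fun_cover A : set (nat -> S -> R) := [set g |
  [/\ forall k, BL (g k), forall k x, 0 <= g k x &
      forall x, A x -> (1 <= \sum_(k <oo) (g k x)%:E)%E]].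

(** Daniell's outer measure. With series of functions in place of countable covers by
    sets, countable subadditivity and the measurability of open sets rest on the
    additivity and positivity of [psi]; the Daniell property gives the total mass. *)
Definition fun_outer A : \bar R :=
  ereal_inf [set \sum_(k <oo) (psi (g k))%:E | g in fun_cover A]%E.

Let psi0 g k A : fun_cover A g -> (0 <= (psi (g k))%:E)%E.
Proof. by move=> [bg g0 _]; rewrite lee_fin; exact: pos_ge0. Qed.

Lemma fun_outer_ge0 A : (0 <= fun_outer A)%E.
Proof.
apply: le_ereal_inf_tmp => _ [g gA <-]; apply: nneseries_ge0 => k _ _.
exact: psi0 gA.
Qed.

Lemma le_fun_outer : {homo fun_outer : A X / A `<=` X >-> (A <= X)%E}.
Proof.
move=> A X AX; apply/ereal_inf_le_tmp => _ [g [bg g0 gX] <-]; exists g => //.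
by split=> // x /AX/gX.
Qed.

Lemma fun_outer_le f A : BL f -> (forall x, 0 <= f x) ->
  (forall x, A x -> 1 <= f x) -> (fun_outer A <= (psi f)%:E)%E.
Proof.
move=> bf f0 fA; pose g k := if k is 0%N then f else fun=> 0 : R.
apply: ereal_inf_lbound; exists g.
  split=> [[|k]//|[|k] x//|x Ax]; first exact: BL_cst.
  by rewrite eseries_first// lee_fin fA.
by rewrite eseries_first// => k; rewrite /g pos0.
Qed.

Lemma fun_outer0 : fun_outer set0 = 0%E.
Proof.
apply/eqP; rewrite eq_le fun_outer_ge0 andbT.
have -> : 0%E = (psi (fun=> 0))%:E by rewrite pos0.
by apply: fun_outer_le => //; exact: BL_cst.
Qed.

Lemma fun_outer_sigma_subadditive : sigma_subadditive fun_outer.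
Proof.
move=> A; have [[i ioo]|] := pselect (exists i, fun_outer (A i) = +oo%E).
  rewrite (eseries_pinfty _ _ ioo) ?leey// => n _.
  by rewrite -ltNye (lt_le_trans _ (fun_outer_ge0 _)).
rewrite -forallNE => Aoo.
apply/lee_addgt0Pr => e e0.
rewrite (le_trans _ (epsilon_trick _ _ (ltW e0)))//; last first.
  by move=> n; exact: fun_outer_ge0.
have exG n : exists g, fun_cover (A n) g /\
    (\sum_(k <oo) (psi (g k))%:E <= fun_outer (A n) + (e / (2 ^ n.+1)%:R)%:E)%E.
  have en : 0 < e / (2 ^ n.+1)%:R by rewrite divr_gt0// ltr0n expn_gt0.
  have fin : fun_outer (A n) \is a fin_num.
    by rewrite ge0_fin_numE ?fun_outer_ge0// ltey; apply/eqP/Aoo.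
  have [_ [g gA <-] gle] := lb_ereal_inf_adherent en fin.
  by exists g; split => //; exact: ltW.
have [G GP] := choice exG.
have [f fP] := @nneseries_pairing R.
apply: (@le_trans _ _ (\sum_(i <oo) \sum_(j <oo) (psi (G i j))%:E)%E).
  rewrite -fP; last by move=> i j; exact: psi0 (GP i).1.
  apply: ereal_inf_lbound; exists (fun k => G (f k).1 (f k).2) => //.
  have G0 i j x : 0 <= G i j x by have [[]] := GP i.
  split=> [k|k x|x [n _ An]].
  - by have [[]] := GP (f k).1.
  - exact: G0.
  - rewrite (fP (fun i j => (G i j x)%:E)); last by move=> i j; rewrite lee_fin.
    have [[_ _ /(_ x An) G1] _] := GP n; apply: le_trans G1 _.
    apply: (@nneseries_term _ (fun i => \sum_(j <oo) (G i j x)%:E)%E) => i.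
    by apply: nneseries_ge0 => j _ _; rewrite lee_fin.
apply: lee_nneseries => [n _ _|n _]; last exact: (GP n).2.
by apply: nneseries_ge0 => j _ _; exact: psi0 (GP n).1.
Qed.

(** The witness is the distance to the complement, capped at 1; its multiples,
    truncated, increase to the indicator of the open set. *)
Lemma open_positivity_set (U : set S) : open U ->
  exists u : S -> R, [/\ BL u, forall x, 0 <= u x & forall x, U x <-> 0 < u x].
Proof.
move=> oU; have [UT|/existsNP[y0 Uy0]] := pselect (forall x, U x).
  by exists (fun=> 1); split=> [|//|x]; [exact: BL_cst|split].
pose D x := [set Num.min 1 (mdist x y) | y in ~` U].
have D0 x : lbound (D x) 0.
  by move=> _ [y _ <-]; rewrite le_min ler01 mdist_ge0.
have Dn x : D x !=set0 by exists (Num.min 1 (mdist x y0)), y0.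
have Dinf x : has_inf (D x) by split=> //; exists 0.
pose u x := inf (D x).
have u0 x : 0 <= u x by apply: lb_le_inf.
have ule x y : ~ U y -> u x <= Num.min 1 (mdist x y).
  by move=> Uy; apply: ge_inf => //; [exists 0|exists y].
have uL x y : u x - u y <= mdist x y.
  rewrite lerBlDr addrC -lerBlDr; apply: lb_le_inf => // _ [z Uz <-].
  rewrite lerBlDr; apply: le_trans (ule x z Uz) _.
  rewrite addr_minl le_min !ge_min lerDl mdist_ge0/=.
  by rewrite addrC metric_triangle orbT.
exists u; split => //.
  apply: (@bounded_lip_BL _ _ 1 1); split=> [x|x y].
    by rewrite ger0_norm// (le_trans (ule x _ Uy0))// ge_min lexx.
  by rewrite mul1r ler_norml uL andbT lerNl opprB metric_sym uL.
move=> x; split=> [Ux|]; last first.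
  move=> ux; apply: contrapT => /(ule x); rewrite mdistxx leNgt => /negP; apply.
  by rewrite (le_lt_trans _ ux)// ge_min lexx orbT.
have /nbhs_ballP[r /= r0 rU] := open_nbhs_nbhs (conj oU Ux).
apply: lt_le_trans (_ : Num.min 1 r <= _); first by rewrite lt_min ltr01.
apply: lb_le_inf => // _ [y Uy <-]; rewrite le_min !ge_min lexx/=.
rewrite [X in _ || X](_ : _ = true) ?orbT// leNgt; apply: contra_notN Uy => xy.
by apply: rU; rewrite ballEmdist.
Qed.

(** Caratheodory's criterion. For a cover [g] of [X], the slices
    [g k * (p m.+1 - p m)] of the cutoffs [p m] increasing to the indicator of [U]
    cover [X `&` U], and the [g k * (1 - p (n k))] cover the rest of [X]; choosing
    [n k] large makes the two totals add up to that of [g], up to [e]. *)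
Lemma caratheodory_open (om : {outer_measure set S -> \bar R}) (U : set S) :
  (forall A, om A = fun_outer A) -> open U -> om.-caratheodory U.
Proof.
move=> omE oU; apply: le_caratheodory_measurable => X; rewrite !omE.
apply: le_ereal_inf_tmp => _ [g [bg g0 gX] <-].
have [u [bu u0 uU]] := open_positivity_set oU.
pose p m x := clamp (m%:R * u x).
have bp m : BL (p m) by apply: BL_clamp; exact: BLZ.
have p0 x : p 0%N x = 0 by rewrite /p mul0r clamp0.
have p_ge0 m x : 0 <= p m x := clamp_ge0 _.
have p_le1 m x : p m x <= 1 := clamp_le1 _.
have p_nd m x : p m x <= p m.+1 x.
  by apply: le_clamp; rewrite ler_wpM2r// ler_nat.
have p1 x : U x -> \forall m \near \oo, p m x = 1.
  move=> /uU ux; exists (Num.truncn (u x)^-1).+1 => // m /= um.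
  rewrite /p clamp1// -ler_pdivrMr// div1r (le_trans (ltW (truncnS_gt _)))//.
  by rewrite ler_nat.
have pU x : ~ U x -> forall m, p m x = 0.
  move=> Ux m; suff ux : u x = 0 by rewrite /p ux mulr0 clamp0.
  by apply/eqP; rewrite eq_le u0 andbT leNgt; apply/negP => /uU.
pose q m x := p m.+1 x - p m x.
have bq m : BL (q m) := BLB (bp _) (bp _).
have q0 m x : 0 <= q m x by rewrite subr_ge0.
have sumq n x : \sum_(m < n) q m x = p n x.
  elim: n => [|n IH]; first by rewrite big_ord0 p0.
  by rewrite big_ord_recr/= IH /q addrC subrK.
have gq0 k m x : 0 <= g k x * q m x by rewrite mulr_ge0.
have bgq k m : BL (fun x => g k x * q m x) := BLM (bg k) (bq m).
pose s k : \bar R := (\sum_(m <oo) (psi (fun x => g k x * q m x))%:E)%E.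
have psigq n k : \sum_(m < n) psi (fun x => g k x * q m x) =
    psi (fun x => g k x * p n x).
  rewrite -(pos_sum psiP (g := fun m x => g k x * q m x))//.
  by congr psi; apply/funext => x; rewrite -mulr_sumr sumq.
have sE n k : (\sum_(0 <= m < n) (psi (fun x => g k x * q m x))%:E)%E =
    (psi (fun x => g k x * p n x))%:E.
  by rewrite sumEFin big_mkord psigq.
have bgp n k : BL (fun x => g k x * p n x) := BLM (bg k) (bp n).
have gp0 n k x : 0 <= g k x * p n x by rewrite mulr_ge0.
have psigp n k : psi (fun x => g k x * p n x) <= psi (g k).
  by apply: pos_le => // x; rewrite gp0 ler_piMr.
have cvg_s k : cvgn (fun n => \sum_(0 <= m < n) (psi (fun x => g k x * q m x))%:E)%E.
  by apply: is_cvg_nneseries => m _ _; rewrite lee_fin; exact: pos_ge0.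
have sle k : (s k <= (psi (g k))%:E)%E.
  by apply: lime_le => //; apply: nearW => n; rewrite sE lee_fin.
have s0 k : (0 <= s k)%E.
  by apply: nneseries_ge0 => m _ _; rewrite lee_fin; exact: pos_ge0.
have [f fP] := @nneseries_pairing R.
have sU : (fun_outer (X `&` U) <= \sum_(k <oo) s k)%E.
  rewrite -(fP (fun k m => (psi (fun x => g k x * q m x))%:E)); last first.
    by move=> k m; rewrite lee_fin; exact: pos_ge0.
  apply: ereal_inf_lbound.
  exists (fun i x => g (f i).1 x * q (f i).2 x) => //; split => // x [Xx Ux].
  rewrite (fP (fun k m => (g k x * q m x)%:E)); last first.
    by move=> k m; rewrite lee_fin.
  apply: le_trans (gX _ Xx) _; apply: lee_nneseries => k _.
    by rewrite lee_fin.
  apply: lime_ge; first by apply: is_cvg_nneseries => m _ _; rewrite lee_fin.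
  apply: filterS (p1 _ Ux) => n pn.
  by rewrite sumEFin big_mkord -mulr_sumr sumq pn mulr1.
apply/lee_addgt0Pr => e e0.
have exn k : exists n,
    (s k <= (psi (fun x => g k x * p n x) + e / (2 ^ k.+1)%:R)%:E)%E.
  have ek : 0 < e / (2 ^ k.+1)%:R by rewrite divr_gt0// ltr0n expn_gt0.
  have /fineK sk : s k \is a fin_num.
    by rewrite ge0_fin_numE// (le_lt_trans (sle k)) ?ltry.
  apply: contrapT => /forallNP nk.
  have : (s k <= (fine (s k) - e / (2 ^ k.+1)%:R)%:E)%E.
    apply: lime_le => //; apply: nearW => n; rewrite sE lee_fin lerBrDr leNgt.
    by apply/negP => kn; apply: (nk n); rewrite -sk lee_fin ltW.
  by rewrite -{1}sk lee_fin; lra.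
have [n nP] := choice exn.
have sC : (fun_outer (X `&` ~` U) <=
    \sum_(k <oo) (psi (fun x => g k x * (1 - p (n k) x)))%:E)%E.
  apply: ereal_inf_lbound; exists (fun k x => g k x * (1 - p (n k) x)) => //.
  split=> [k|k x|x [Xx Ux]].
  - by apply: BLM => //; apply: BLB => //; exact: BL_cst.
  - by rewrite mulr_ge0// subr_ge0.
  - apply: le_trans (gX _ Xx) _; apply: lee_nneseries => k _.
      by rewrite lee_fin.
    by rewrite pU// subr0 mulr1.
have psiC k : psi (fun x => g k x * (1 - p (n k) x)) =
    psi (g k) - psi (fun x => g k x * p (n k) x).
  have [padd _ _] := psiP; apply/eqP; rewrite eq_sym subr_eq addrC -padd//.
  - by apply/eqP; congr psi; apply/funext => x; ring.
  - by apply: BLM => //; apply: BLB => //; exact: BL_cst.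
  - by move=> x; rewrite mulr_ge0// subr_ge0.
have psiC0 k : 0 <= psi (fun x => g k x * (1 - p (n k) x)).
  by rewrite psiC subr_ge0.
apply: le_trans (leeD sU sC) _.
rewrite -nneseriesD//; last by move=> k _ _; rewrite lee_fin.
apply: le_trans _ (epsilon_trick _ _ (ltW e0)); last first.
  by move=> k; rewrite lee_fin; exact: pos_ge0.
apply: lee_nneseries => k _; first by rewrite adde_ge0// lee_fin.
apply: le_trans (leeD2r _ (nP k)) _.
by rewrite -!EFinD lee_fin psiC; lra.
Qed.

Lemma measure_of_positive_tight :
  exists m : {finite_measure set (Borel S) -> \bar R}, forall A, m A = fun_outer A.
Proof.
pose om : {outer_measure set S -> \bar R} := HB.pack fun_outer
  (isOuterMeasure.Build R S fun_outer fun_outer0 fun_outer_ge0 le_fun_outer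
    fun_outer_sigma_subadditive).
have sub A : (@open S).-sigma.-measurable A -> om.-cara.-measurable A.
  apply: (@smallest_sub _ _ (@open S) (om.-cara.-measurable)).
    split => //; [by move=> X mX; rewrite setTD; exact: measurableC |
                by move=> u_ mu_; exact: bigcupT_measurable].
  by move=> U oU; exact: (@caratheodory_open om).
have add : semi_sigma_additive (fun_outer : set (Borel S) -> \bar R).
  move=> F mF tF mUF.
  apply: (@caratheodory_measure_sigma_additive _ _ om) => //; last exact: sub.
  by move=> i; exact: (sub _ (mF i)).
pose mu0 : set (Borel S) -> \bar R := fun_outer.
pose m : {measure set (Borel S) -> \bar R} := HB.pack mu0
  (isMeasure.Build _ (Borel S) R mu0 fun_outer0 fun_outer_ge0 add).
have fin : fin_num_fun m.
  move=> A mA; rewrite ge0_fin_numE ?measure_ge0//.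
  apply: le_lt_trans (ltry (psi (fun=> 1))).
  by apply: fun_outer_le => //; exact: BL_cst.
pose m' : {finite_measure set (Borel S) -> \bar R} := HB.pack
  (m : set (Borel S) -> \bar R)
  (Measure.class m) (Measure_isFinite.Build _ (Borel S) R m fin).
by exists m'.
Qed.

End measure_of_functional.

(** * Representation of tight functionals *)

Section representation.
Context {R : realType} {S : completeMetricType R}.
Implicit Types f : S -> R.
Variable psi : (S -> R) -> R.
Hypothesis psiP : positive_tight psi.
Variable m : {finite_measure set (Borel S) -> \bar R}.
Hypothesis mE : forall A, m A = fun_outer psi A.

(** The total mass is where the Daniell property enters: no countable cover of the
    space by functions can cost less than [psi 1]. *)
Lemma mass_of_functional : m setT = (psi (fun=> 1))%:E.
Proof.
rewrite mE; apply/eqP; rewrite eq_le; apply/andP; split.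
  by apply: fun_outer_le => //; exact: BL_cst.
apply: le_ereal_inf_tmp => _ [g [bg g0 gT] <-].
apply/lee_addgt0Pr => e e0.
have [|n gn] := pos_daniell psiP bg g0 _ e0.
  move=> x r r0; apply: contrapT => /forallNP ng.
  have : (\sum_(k <oo) (g k x)%:E <= (1 - r)%:E)%E.
    apply: lime_le; first by apply: is_cvg_nneseries => k _ _; rewrite lee_fin.
    apply: nearW => n; rewrite sumEFin big_mkord lee_fin leNgt.
    exact/negP/ng.
  by move/(le_trans (gT x I)); rewrite lee_fin; lra.
apply: le_trans (_ : (\sum_(k < n) psi (g k) + e)%:E <= _)%E.
  by rewrite lee_fin.
rewrite EFinD leeD2r// -sumEFin -(big_mkord xpredT (fun k => (psi (g k))%:E)).
by apply: nneseries_lim_ge => k _ _; rewrite lee_fin; exact: pos_ge0.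
Qed.

Let mu1 : fine (m setT) = psi (fun=> 1).
Proof. by rewrite mass_of_functional. Qed.

(** Layer by layer, [f] is at most the sum of the indicators of [f > i], and the
    truncation of [f] between [i] and [i.+1] covers [f > i.+1]: the integral exceeds
    [psi f] by at most the mass of the level [f > 0]. *)
Lemma int_le_functional_mass f : BL f -> (forall x, 0 <= f x) ->
  \int[m]_x f x <= psi (fun=> 1) + psi f.
Proof.
move=> bf f0; have [C [L [C0 _ [fC _]]]] := (BLP f).1 bf.
pose K := (Num.truncn C).+1.
have fK x : 0 <= f x <= K%:R.
  rewrite f0/=; apply: le_trans (ler_norm _) _; apply: le_trans (fC x) _.
  by apply/ltW; exact: truncnS_gt.
pose A i : set (Borel S) := [set x | i%:R < f x].
have mA i : measurable (A i).
  apply: sub_sigma_algebra; rewrite (_ : A i = f @^-1` [set t | i%:R < t])//.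
  by apply: open_comp; [move=> x _; exact: BL_continuous|exact: open_gt].
pose c i x := clamp (f x - i%:R).
have bc i : BL (c i) by apply: BL_clamp; apply: BLB => //; exact: BL_cst.
have c0 i x : 0 <= c i x := clamp_ge0 _.
have cA i x : c i x <= \1_(A i) x.
  rewrite indicE; have [xA|xA] := boolP (x \in A i); first exact: clamp_le1.
  rewrite /c clamp0// subr_le0 leNgt; apply/negP => fx.
  by move/negP: xA; apply; rewrite inE.
have intA i : m.-integrable setT (EFin \o \1_(A i)).
  exact: integrable_indic.
have fA x : f x <= \sum_(i < K) \1_(A i) x.
  by rewrite -[leLHS](sum_clamp (fK x)); apply: ler_sum => i _; exact: cA.
have intsum n : m.-integrable setT (EFin \o (fun x => \sum_(i < n) \1_(A i) x)) /\
    \int[m]_x (\sum_(i < n) \1_(A i) x) = \sum_(i < n) fine (m (A i)).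
  elim: n => [|n [In En]].
    rewrite big_ord0; under eq_fun do rewrite big_ord0.
    by split; [exact: integrable0|rewrite Rintegral_cst// mul0r].
  under eq_fun do rewrite big_ord_recr/=.
  rewrite big_ord_recr/= -En RintegralD//; split; last first.
    by congr (_ + _); rewrite /Rintegral integral_indic// setIT.
  exact: (integrableD measurableT In (intA n)).
have [isum Esum] := intsum K.
apply: (@le_trans _ _ (\sum_(i < K) fine (m (A i)))).
  by rewrite -Esum; apply: le_Rintegral => //; exact: BL_integrable.
apply: (@le_trans _ _ (\sum_(i < K.+1) fine (m (A i)))).
  by rewrite [leRHS]big_ord_recr/= lerDl fine_ge0.
rewrite big_ord_recl/=; apply: lerD.
  rewrite -mu1 fine_le ?fin_num_measure//.
  by apply: le_measure; rewrite ?inE//.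
have -> : psi f = \sum_(i < K) psi (c i).
  rewrite -pos_sum//; congr psi; apply/funext => x; exact/esym/sum_clamp.
apply: ler_sum => i _; rewrite -lee_fin fineK ?fin_num_measure// mE.
apply: fun_outer_le => // x; rewrite -[bump 0 i]/(i.+1) /A /= -natr1 => fx.
by rewrite /c clamp1//; lra.
Qed.

(** Applied to large multiples of [f], the previous bound loses its additive term. *)
Lemma int_le_functional f : BL f -> (forall x, 0 <= f x) ->
  \int[m]_x f x <= psi f.
Proof.
move=> bf f0; rewrite leNgt; apply/negP => lt.
have d0 : 0 < \int[m]_x f x - psi f by rewrite subr_gt0.
set n := (Num.truncn (psi (fun=> 1) / (\int[m]_x f x - psi f))).+1.
have nP : psi (fun=> 1) < n%:R * (\int[m]_x f x - psi f).
  by rewrite -ltr_pdivrMr// truncnS_gt.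
have := int_le_functional_mass (BLZ n%:R bf) (fun x => mulr_ge0 (ler0n _ _) (f0 x)).
rewrite RintegralZl//; last exact: BL_integrable.
by rewrite pos_mulrn//; lra.
Qed.

(** Comparing the masses turns the inequality, applied to [K - f], into the converse
    one for [f]. *)
Lemma int_functional f : BL f -> (forall x, 0 <= f x) ->
  \int[m]_x f x = psi f.
Proof.
move=> bf f0; apply/eqP; rewrite eq_le int_le_functional//=.
have [C [L [C0 _ [fC _]]]] := (BLP f).1 bf.
pose K := (Num.truncn C).+1.
have fK x : f x <= K%:R.
  apply: le_trans (ler_norm _) _; apply: le_trans (fC x) _.
  by apply/ltW; exact: truncnS_gt.
have bK : BL (fun _ : S => K%:R : R) := BL_cst _.
have bd := BLB bK bf.
have d0 x : 0 <= K%:R - f x by rewrite subr_ge0.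
have := int_le_functional bd d0.
rewrite RintegralB//; [|exact: BL_integrable|exact: BL_integrable].
rewrite Rintegral_cst// mu1 -(pos_mulrn psiP K (BL_cst 1))//.
have -> : psi (fun x => K%:R * 1) = psi f + psi (fun x => K%:R - f x).
  case: psiP => padd _ _; rewrite -padd//; congr psi; apply/funext => x.
  by rewrite mulr1 addrC subrK.
lra.
Qed.

End representation.

(** The signed form: the positive parts of [phi] and [- phi] are integrals, and
    adding a constant reduces to nonnegative functions. *)
Lemma representation {R : realType} {S : completeMetricType R} (M : R)
    (phi : (S -> R) -> R) : linear_on_BL phi -> bounded_by M phi -> lip_tight phi ->
  exists mu : signed_measure R S, forall f, BL f -> phi f = pairing mu f.
Proof.
move=> linphi bndphi tightphi; pose phiN g := - phi g.
have linN : linear_on_BL phiN.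
  by move=> a g h bg bh; rewrite /phiN linphi//; ring.
have bndN : bounded_by M phiN by move=> C g bg gC; rewrite normrN; exact: bndphi.
have tightN : lip_tight phiN.
  move=> d e L d0 e0 L0; have [F FP] := tightphi d e L d0 e0 L0.
  by exists F => f fb fF; rewrite normrN; exact: FP.
have pP := positive_tight_fun_pos linphi bndphi tightphi.
have pN := positive_tight_fun_pos linN bndN tightN.
have [p pE] := measure_of_positive_tight pP.
have [q qE] := measure_of_positive_tight pN.
exists (cadd (charge_of_finite_measure p) (copp (charge_of_finite_measure q))).
move=> f bf; rewrite (pairing_difference (p := p) (q := q) bf)//.
have pos g : BL g -> (forall x, 0 <= g x) ->
    phi g = \int[p]_x g x - \int[q]_x g x.
  move=> bg g0; rewrite (int_functional pP pE)// (int_functional pN qE)//.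
  exact: fun_pos_sub bndphi _ _.
have [C [L [C0 _ [fC _]]]] := (BLP f).1 bf.
have bC : BL (fun _ : S => C) := BL_cst _.
have fC0 x : 0 <= f x + C by have := fC x; rewrite ler_norml; lra.
have := pos _ (BLD bf bC) fC0; have := pos _ bC (fun=> C0).
rewrite (linD linphi)//.
by rewrite !RintegralD//; try exact: BL_integrable; lra.
Qed.

(** * Convergence in the dual norm *)

Lemma unit_ball_bounded_lip {R : realType} {S : completeMetricType R} (f : S -> R) :
  (BL_norm f <= 1)%E -> bounded_lip 1 1 f.
Proof.
move=> f1; have lip0 : (0 <= lip_seminorm f)%E by rewrite le_max lexx.
have sup0 : (0 <= sup_norm f)%E.
  apply: le_trans (_ : (`|f point|%:E <= _)%E); first by rewrite lee_fin.
  by apply: ereal_sup_ubound; exists point.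
have lip1 : (lip_seminorm f <= 1)%E by apply: le_trans f1; rewrite leeDr.
have sup1 : (sup_norm f <= 1)%E by apply: le_trans f1; rewrite leeDl.
split=> [x|x y].
  by rewrite -lee_fin (le_trans _ sup1)//; apply: ereal_sup_ubound; exists x.
rewrite mul1r; have [->|xy] := eqVneq x y; first by rewrite subrr normr0 mdist_ge0.
rewrite -[leRHS]mul1r -ler_pdivrMr ?mdist_gt0// -lee_fin.
apply: le_trans lip1; rewrite /lip_seminorm le_max; apply/orP; right.
by apply: ereal_sup_ubound; exists (x, y).
Qed.

Theorem theorem3p1 (R : realType) (S : completeMetricType R)
  (separableS : separable_space S)
  (mu_ : nat -> signed_measure R S)
  (TV_bounded : (ereal_sup [set TV_norm (mu_ n) | n in [set: nat]] < +oo)%E)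
  (pairing_cvg : forall f : S -> R, BL f -> cvg (pairing (mu_ n) f @[n --> \oo])) :
  exists mu : signed_measure R S,
    BL_dual_norm (cadd (mu_ n) (copp mu)) @[n --> \oo] --> 0%E.
Proof.
have [M TVM] : exists M : R, forall n, (TV_norm (mu_ n) <= M%:E)%E.
  have TVle n :
      (TV_norm (mu_ n) <= ereal_sup [set TV_norm (mu_ n) | n in [set: nat]])%E.
    by apply: ereal_sup_ubound; exists n.
  have TV0 : (0 <= TV_norm (mu_ 0%N))%E by rewrite adde_ge0.
  exists (fine (ereal_sup [set TV_norm (mu_ n) | n in [set: nat]])) => n.
  by rewrite fineK// ge0_fin_numE// (le_trans TV0).
have lin n : linear_on_BL (pairing (mu_ n)) := linear_pairing _.
have bnd n : bounded_by M (pairing (mu_ n)) := bounded_pairing (TVM n).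
have tgt n : tight (pairing (mu_ n)) := tight_pairing _ separableS.
have [mu muE] := representation (linear_lim lin pairing_cvg)
  (bounded_lim bnd pairing_cvg) (lip_tight_lim lin bnd tgt pairing_cvg).
exists mu; have dual_ge0 n : (0 <= BL_dual_norm (cadd (mu_ n) (copp mu)))%E.
  apply: le_trans (_ : `|pairing (cadd (mu_ n) (copp mu)) (fun=> 0)|%:E <= _)%E.
    by rewrite lee_fin.
  apply: ereal_sup_ubound; exists (fun=> 0) => //; split; first exact: BL_cst.
  apply: (@le_trans _ _ (0 + 0)%E); last by rewrite adde0 lee_fin.
  apply: leeD; rewrite /sup_norm /lip_seminorm ?ge_max ?lexx /=;
    apply: ge_ereal_sup => _ [x _ <-]; rewrite lee_fin ?subrr normr0//.
  by rewrite mul0r.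
have dual_le (e : R) : 0 < e -> \forall n \near \oo,
    (BL_dual_norm (cadd (mu_ n) (copp mu)) <= e%:E)%E.
  move=> e0; have [N NP] := cvg_dual lin bnd tgt pairing_cvg e0.
  exists N => // n /= Nn; apply: ge_ereal_sup => _ [f [bf f1] <-].
  rewrite lee_fin pairingB// -muE//.
  exact: NP (unit_ball_bounded_lip f1).
apply/fine_cvgP; split.
  apply: filterS (dual_le _ ltr01) => n dn.
  by rewrite ge0_fin_numE// (le_lt_trans dn) ?ltry.
apply/cvgrPdist_le => e e0; apply: filterS (dual_le _ e0) => n dn.
rewrite sub0r normrN ger0_norm ?fine_ge0//= -lee_fin fineK//.
by rewrite ge0_fin_numE// (le_lt_trans dn) ?ltry.
Qed.
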